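(* Let $k,\ell,d$ be integers with $k+2\leq\ell\leq d$ and let $\beta,p\in(0,1]$. Let $\Gamma$ be a group, abelian if $k>1$. Let $X$ be a $d$-partite simplicial complex such that \[\Pr_{F\in\binom{[d]}{\ell}}\big[X^F\text{ is }(k,\beta)\text{-locally coboundary expanding}\big]\geq p,\] where $F$ is a uniformly random $\ell$-subset of $[d]$. Then $X$ is a coboundary expander at level $k$ (i.e. $Z^k(X,\Gamma)=B^k(X,\Gamma)$) and $h^k(X,\Gamma)\geq\frac{p\beta^{k+1}}{e(k+2)!}$, where $e$ is Euler's number.
   Context: A $d$-partite simplicial complex is a finite pure $(d-1)$-dimensional simplicial complex $X$ with a partition $X(0)=V_1\sqcup\dots\sqcup V_d$ such that every maximal face meets every $V_i$ in exactly one vertex; $\mathrm{col}(t)=\{i:t\cap V_i\neq\emptyset\}$. $X$ carries a full-support probability distribution on maximal faces, inducing distributions on each level $X(i)$ ($i+1$-element faces) by $\Pr_i(t)=\binom{d}{i+1}^{-1}\sum_{s\supseteq t\text{ maximal}}\Pr(s)$. For $F\subseteq[d]$, $X^F=\{s\in X:\mathrm{col}(s)\subseteq F\}$, a pure $(|F|-1)$-dimensional complex whose maximal faces $s$ get weight proportional to $\sum_{t\supseteq s\text{ maximal in }X}\Pr(t)$; for a face $s$ with $\mathrm{col}(s)\cap F=\emptyset$, $X^F_s=\{t\in X^F:t\cup s\in X\}$ with top-face weights proportional to the total weight of maximal faces of $X$ containing $t\cup s$. Cochains: $C^i(Y,\Gamma)$ = functions on ordered $i$-faces of $Y$ with $f(v_{\pi(0)},\dots,v_{\pi(i)})=f(v_0,\dots,v_i)^{\mathrm{sign}\pi}$,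 $C^{-1}$ = functions on $\{\emptyset\}$; abelian $\delta f(s)=\sum_j(-1)^jf(s_j)$ ($s_j$ deletes the $j$-th vertex); non-abelian $\delta_{-1}h(v)=h(\emptyset)$, $\delta_0h(vu)=h(v)h(u)^{-1}$, $\delta_1h(vuw)=h(vu)h(uw)h(wv)$. $\mathrm{wt}$, $\mathrm{dist}$ are measured with the level distributions; $B^i=\mathrm{Im}\,\delta_{i-1}$, $Z^i=\ker\delta_i$; for $Y$ with $Z^i(Y,\Gamma)=B^i(Y,\Gamma)$, $h^i(Y,\Gamma)=\min_{f\in C^i\setminus B^i}\mathrm{wt}(\delta f)/\mathrm{dist}(f,B^i)$. $X^F$ is $(k,\beta)$-locally coboundary expanding if $Z^k(X^F,\Gamma)=B^k(X^F,\Gamma)$, $h^k(X^F,\Gamma)\geq\beta$, and for every $0\le j\le k$ and every face $s\in X(j)$ with $\mathrm{col}(s)\cap F=\emptyset$: $Z^{k-|s|}(X_s^F,\Gamma)=B^{k-|s|}(X_s^F,\Gamma)$ and $h^{k-|s|}(X^F_s,\Gamma)\geq\beta$. *)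

(* Defs.v *)
From mathcomp Require Import all_boot all_order all_algebra all_fingroup.
From mathcomp Require Import boolp classical_sets reals constructive_ereal ereal.
From mathcomp Require Import sequences exp.

Set Implicit Arguments.
Unset Strict Implicit.
Unset Printing Implicit Defensive.

Import Order.TTheory GRing.Theory Num.Theory.
Local Open Scope ring_scope.

(* Levels, cochains, coboundaries and expansion are all indexed by the number
   n of vertices of the faces concerned, i.e. n stands for dimension n - 1:
   C^i, Z^i, B^i, h^i are taken at n = i + 1, and C^{-1} at n = 0. *)

(* Raw data; the axioms are in [partite_complex]. Only the values of [weight]
   on maximal faces are ever used. *)
Record wcomplex (R : realType) (V : finType) := WComplex {
  faces : {set {set V}};
  weight : {set V} -> R }.

Section WeightedComplex.
Variables (R : realType) (V : finType).
Implicit Types (Y : wcomplex R V) (s t : {set V}).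

Definition maxfaces Y : {set {set V}} :=
  [set s | maxset (fun t => t \in faces Y) s].

(* The dimension of Y plus one. *)
Definition rank Y : nat := \max_(s in faces Y) #|s|.

Definition level Y (n : nat) : {set {set V}} := [set t in faces Y | #|t| == n].

Definition mass Y t : R := \sum_(s in maxfaces Y | t \subset s) weight Y s.

Definition level_pr Y t : R := ('C(rank Y, #|t|)%:R)^-1 * mass Y t.

Definition Pr Y (n : nat) (P : pred {set V}) : R :=
  \sum_(t in level Y n | P t) level_pr Y t.

(* The complex with faces A and top weights proportional to m. *)
Definition normalized (A : {set {set V}}) (m : {set V} -> R) : wcomplex R V :=
  WComplex A (fun s => m s / \sum_(u in maxfaces (WComplex A m)) m u).

End WeightedComplex.

Section Partite.
Variables (R : realType) (V : finType) (d : nat).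
Implicit Types (X : wcomplex R V) (c : V -> 'I_d) (F : {set 'I_d}).

(* The vertex parts are the fibers of c; elements of V lying in no face of X
   are not vertices of X and play no role. *)
Record partite_complex X c : Prop := PartiteComplex {
  faces_closed : forall s t : {set V},
    s \in faces X -> t \subset s -> t \in faces X;
  faces_pure : forall s, s \in maxfaces X -> #|s| = d;
  faces_partite : forall s (i : 'I_d),
    s \in maxfaces X -> #|[set v in s | c v == i]| = 1%N;
  weight_gt0 : forall s, s \in maxfaces X -> 0 < weight X s;
  weight_sum1 : \sum_(s in maxfaces X) weight X s = 1 }.

Definition col c (t : {set V}) : {set 'I_d} := [set c v | v in t].

(* X^F *)
Definition color_restr X c F : wcomplex R V :=
  normalized [set s in faces X | col c s \subset F] (mass X).

(* X^F_s *)
Definition color_link X c F (s : {set V}) : wcomplex R V :=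
  normalized [set t in faces (color_restr X c F) | t :|: s \in faces X]
             (fun t => mass X (t :|: s)).

End Partite.

Section Cochains.
Variables (R : realType) (V : finType) (G : groupType).
Implicit Types (Y : wcomplex R V).
Local Open Scope group_scope.

Definition oface Y n (t : n.-tuple V) : bool :=
  uniq t && ([set v in t] \in faces Y).

(* C^{n-1}(Y, G). A cochain is a function on ordered faces; it is represented
   by a function on all n-tuples, whose values outside the ordered faces of Y
   are irrelevant: all the notions below are insensitive to them. *)
Definition cochains Y n : set (n.-tuple V -> G) :=
  fun f => forall (t : n.-tuple V) (pi : 'S_n), oface Y t ->
    f [tuple tnth t (pi i) | i < n] = if odd_perm pi then (f t)^-1 else f t.

Definition delv n (t : n.+1.-tuple V) (j : 'I_n.+1) : n.-tuple V :=
  [tuple tnth t (lift j i) | i < n].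

(* The coboundary of (n-1)-cochains. The first three cases are the non-abelian
   formulas; from n = 3 on, G is meant to be abelian. When G is abelian the
   first three cases agree with the alternating formula of the last one, up to
   a global inversion for n = 1, which affects neither kernels, images nor
   weights. *)
Definition cobd n : (n.-tuple V -> G) -> n.+1.-tuple V -> G :=
  match n return (n.-tuple V -> G) -> n.+1.-tuple V -> G with
  | 0 => fun h _ => h [tuple]
  | 1 => fun h t =>
      let v := tnth t (inord 0) in let u := tnth t (inord 1) in
      h [tuple v] * (h [tuple u])^-1
  | 2 => fun h t =>
      let v := tnth t (inord 0) in let u := tnth t (inord 1) in
      let w := tnth t (inord 2) in
      h [tuple v; u] * h [tuple u; w] * h [tuple w; v]
  | n => fun f t =>
      \prod_(j < n.+1) (if odd j then (f (delv t j))^-1 else f (delv t j))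
  end.

Definition cocycles Y n : set (n.-tuple V -> G) :=
  fun f => cochains Y f /\
    forall t : n.+1.-tuple V, oface Y t -> cobd f t = 1.

(* B^{-1} is trivial, since C^{-2} is. *)
Definition coboundaries Y n : set (n.-tuple V -> G) :=
  match n return set (n.-tuple V -> G) with
  | 0 => fun f => forall t : 0.-tuple V, oface Y t -> f t = 1
  | m.+1 => fun f => exists2 g : m.-tuple V -> G, cochains Y g &
      forall t : m.+1.-tuple V, oface Y t -> f t = cobd g t
  end.

(* Weights and distances are measured on unordered faces: for the functions
   considered, [f t != 1] or [f t != g t] does not depend on the ordering t of
   the face s. *)
Definition wt Y n (f : n.-tuple V -> G) : R :=
  Pr Y n (fun s => [exists t : n.-tuple V, ([set v in t] == s) && (f t != 1)]).

Definition dist Y n (f g : n.-tuple V -> G) : R :=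
  Pr Y n (fun s => [exists t : n.-tuple V, ([set v in t] == s) && (f t != g t)]).

Definition dist_coboundaries Y n (f : n.-tuple V -> G) : R :=
  inf (fun r : R => exists2 g, coboundaries Y g & r = dist Y f g).

End Cochains.

Section Expansion.
Variables (R : realType) (V : finType) (G : groupType).
Implicit Types (Y : wcomplex R V).

(* h^{n-1}(Y, G); the ratio takes finitely many values, so this infimum is a
   minimum, except that it is +oo when all cochains are coboundaries. *)
Definition expansion Y n : \bar R :=
  ereal_inf (fun x : \bar R => exists f : n.-tuple V -> G,
    [/\ cochains Y f, ~ coboundaries Y f &
        x = (wt Y (cobd f) / dist_coboundaries Y f)%:E]).

Definition coboundary_expanding Y n (beta : R) : Prop :=
  @cocycles R V G Y n = @coboundaries R V G Y n /\
  (beta%:E <= expansion Y n)%E.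

(* Dimension k - |s| corresponds to the index k.+1 - #|s|. *)
Definition locally_expanding d (X : wcomplex R V) (c : V -> 'I_d)
    (F : {set 'I_d}) (k : nat) (beta : R) : Prop :=
  coboundary_expanding (color_restr X c F) k.+1 beta /\
  forall (j : nat) (s : {set V}), (j <= k)%N -> s \in level X j.+1 ->
    [disjoint col c s & F] ->
    coboundary_expanding (color_link X c F s) (k.+1 - #|s|) beta.

(* The probability of P for a uniformly random l-subset of the d colors. *)
Definition Pr_subset d (l : nat) (P : {set 'I_d} -> Prop) : R :=
  #|[set F : {set 'I_d} | (#|F| == l) && `[< P F >]]|%:R / 'C(d, l)%:R.

End Expansion.

Arguments expansion {R V} G Y n.
Arguments coboundary_expanding {R V} G Y n beta.
Arguments locally_expanding {R V} G {d} X c F k beta.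
Arguments Pr_subset R {d} l P.

(* Main.v *)
From HB Require Import structures.
Require Import Defs.
From mathcomp Require Import all_boot all_order all_algebra all_fingroup.
From mathcomp Require Import boolp classical_sets reals constructive_ereal ereal.
From mathcomp Require Import sequences exp.
From mathcomp Require Import ring zify fintype finset.

(** Fix a set F of l colors for which X^F is locally expanding, and a cochain
    f. A cochain g with f close to its coboundary is built by induction on the
    number j of vertices of color outside F: for a face s of such vertices, the
    restriction to the link X^F_s of the part of f not yet accounted for is
    nearly a cocycle, so expansion of X^F_s gives the values of g on the faces
    with outside part s. If E_j is the probability that f differs from the
    coboundary of g on a random face with j outside vertices, and D_j the
    probability that the coboundary of f is nontrivial on a random face, one
    dimension higher, with j outside vertices, this yields
    beta E_j <= D_j + j E_(j-1), without the factor beta for j = k + 1, where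
    there is nothing left to correct. Over a uniformly random F each D_j
    averages to wt(delta f), so the bound obtained by unfolding this recursion
    averages to at most (k + 2)! wt(delta f) / beta^(k + 1), and some good F is
    within a factor 1 / p of the average. *)

Import Order.TTheory GRing.Theory Num.Theory.
Local Open Scope ring_scope.
Set Implicit Arguments.
Unset Strict Implicit.
Unset Printing Implicit Defensive.

(* [all_algebra] also exports the column operator of matrices as [col]. *)
Local Notation col := Defs.col.

(** * Faces of X, X^F and the links by color *)

(** The part of [f] left over on the link of [s] fails the cocycle condition at [r] only if the
    coboundary of [f] is nontrivial on s ∪ r, or if [f] disagrees with the coboundary of [g] on (s ∪
    r) \ v for some v in s. Faces of the second kind have one outside vertex fewer: they were
    corrected earlier and later corrections leave them alone. The j choices of v produce j E_(j-1).
    For j = k + 1 a face outside F is instead completed by one vertex of a color in F: if the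
    coboundary of [f] is trivial on the completed face, disagreement on one facet forces
    disagreement on another. The obstacle is that non-abelian cochains cannot be subtracted. They
    occur only for k <= 1, where a face [s] to be corrected has at most one vertex and the leftover
    part has an explicit product formula. The predicate [correctable] isolates what the averaging
    needs from both cases. In the constants, beta is lost once for each of j = 0, ..., k, and
    unfolding a_j = 1 + j a_(j-1) stays below (j + 1)!. *)

Section Complex.
Variables (R : realType) (V : finType) (d : nat).
Variables (X : wcomplex R V) (c : V -> 'I_d).
Hypothesis hX : partite_complex X c.
Implicit Types (s t r u : {set V}) (S F U : {set 'I_d}).

Definition cpart S u : {set V} := [set v in u | c v \in S].

Lemma max_face u : u \in maxfaces X -> u \in faces X.
Proof. by rewrite inE => /maxsetP[]. Qed.

Lemma sub_max_face u t : u \in maxfaces X -> t \subset u -> t \in faces X.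
Proof. by move=> /max_face; apply: (faces_closed hX). Qed.

Lemma face_sub_max t : t \in faces X -> exists2 u, u \in maxfaces X & t \subset u.
Proof.
move=> tX; have [u mu tu] := @maxset_exists _ (fun t => t \in faces X) t tX.
by exists u; rewrite // inE.
Qed.

Lemma col_inj_max u : u \in maxfaces X -> {in u &, injective c}.
Proof.
move=> um v w vu wu cvw.
have /eqP/cards1P[x ex] := faces_partite hX (c v) um.
have : v \in [set z in u | c z == c v] by rewrite inE vu eqxx.
have : w \in [set z in u | c z == c v] by rewrite inE wu -cvw eqxx.
by rewrite ex !inE => /eqP-> /eqP.
Qed.

Lemma col_cpart u S : u \in maxfaces X -> col c (cpart S u) = S.
Proof.
move=> um; apply/setP=> i; apply/imsetP/idP => [[v]|iS].
  by rewrite inE => /andP[_ vS] ->.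
have /eqP/cards1P[x ex] := faces_partite hX i um.
have : x \in [set z in u | c z == i] by rewrite ex set11.
rewrite inE => /andP[xu /eqP cx]; exists x => //.
by rewrite inE xu cx.
Qed.

Lemma cpart_sub u S : cpart S u \subset u.
Proof. by apply/subsetP=> v; rewrite inE => /andP[]. Qed.

Lemma cpart_col u t : u \in maxfaces X -> t \subset u -> cpart (col c t) u = t.
Proof.
move=> um tu; apply/setP=> v; rewrite inE.
apply/andP/idP => [[vu /imsetP[w wt cvw]]|vt].
  by rewrite (col_inj_max um vu (subsetP tu _ wt) cvw).
by split; [apply: (subsetP tu) | apply: imset_f].
Qed.

Lemma card_col t : t \in faces X -> #|col c t| = #|t|.
Proof.
move=> /face_sub_max[u um tu]; rewrite card_in_imset //.
by move=> v w /(subsetP tu) vu /(subsetP tu); apply: (col_inj_max um).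
Qed.

Lemma card_cpart u S : u \in maxfaces X -> #|cpart S u| = #|S|.
Proof.
move=> um; rewrite -{2}(col_cpart S um) card_col //.
exact: sub_max_face (cpart_sub _ _).
Qed.

Lemma weight_ge0 u : u \in maxfaces X -> 0 <= weight X u.
Proof. by move=> /(weight_gt0 hX)/ltW. Qed.

Lemma mass_gt0 t : t \in faces X -> 0 < mass X t.
Proof.
move=> /face_sub_max[u um tu]; rewrite /mass (bigD1 u) /=; last by rewrite um.
apply: ltr_wpDr; last by apply: (weight_gt0 hX).
by apply: sumr_ge0 => w /andP[/andP[wm _] _]; apply: weight_ge0.
Qed.

Lemma face0 : set0 \in faces X.
Proof.
have [e|[u um]] := set_0Vmem (maxfaces X); last by apply: sub_max_face um (sub0set _).
have := weight_sum1 hX; rewrite e big_set0 => /eqP.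
by rewrite eq_sym oner_eq0.
Qed.

Definition link_faces F s : {set {set V}} :=
  [set t in faces X | (col c t \subset F) && (t :|: s \in faces X)].

(** A face contained in a maximal face [u] is determined by its colors, so exchanging the sums
    replaces the faces [r] by color sets [S]. Probabilities in X, X^F and the links all become
    averages over maximal faces of X, which makes these complexes comparable. *)
Lemma sum_link_mass F s n (P : pred {set V}) :
  \sum_(r in link_faces F s | (#|r| == n) && P r) mass X (r :|: s) =
  \sum_(u in maxfaces X | s \subset u) weight X u *
    \sum_(S : {set 'I_d} | (S \subset F) && (#|S| == n)) (P (cpart S u))%:R.
Proof.
rewrite /mass (exchange_big_dep (fun u => (u \in maxfaces X) && (s \subset u))) /=.
  apply: eq_bigr => u /andP[um su]; rewrite -natr_sum mulr_natr.
  rewrite (eq_bigl (fun r => [&& r \subset u, col c r \subset F, #|r| == n & P r])).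
    rewrite (reindex_onto (cpart^~ u) (col c)) /=; last first.
      by move=> r /and4P[ru _ _ _]; apply: cpart_col.
    rewrite sumr_const -sum1_card; congr (_ *+ _); rewrite big_mkcond [RHS]big_mkcond /=.
    apply: eq_bigr => S _.
    rewrite unfold_in /= cpart_sub col_cpart // card_cpart // eqxx andbT /=.
    by rewrite andbA; case: ((S \subset F) && (#|S| == n)); case: (P _).
  move=> r; rewrite inE um subUset su andbT.
  apply/idP/idP => [/and3P[/and3P[/and3P[_ -> _] -> ->] _ ->]//|].
  move=> /and4P[ru -> -> ->]; rewrite ru !andbT /=.
  rewrite (sub_max_face um ru) (sub_max_face um) // subUset ru su //.
by move=> r u _; rewrite subUset => /and3P[-> _ ->].
Qed.

(** X^F is treated as the link of the empty face, so that one computation covers both kinds of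
    complexes. *)
Lemma color_restrE F : color_restr X c F = normalized (link_faces F set0) (fun t => mass X (t :|: set0)).
Proof.
rewrite /color_restr; congr normalized; last by apply: funext => t; rewrite setU0.
by apply/setP=> t; rewrite !inE setU0; case: (t \in _) => //=; rewrite andbT.
Qed.

Lemma color_linkE F s : color_link X c F s = normalized (link_faces F s) (fun t => mass X (t :|: s)).
Proof.
rewrite /color_link; congr normalized.
by apply/setP=> t; rewrite !inE andbA.
Qed.

Section Link.
Variables (F : {set 'I_d}) (s : {set V}).
Hypothesis sX : s \in faces X.
Let Y := normalized (link_faces F s) (fun t => mass X (t :|: s)).

Lemma max_link_faces u : u \in maxfaces X -> s \subset u ->
  forall t, t \subset u -> col c t \subset F -> t \in link_faces F s.
Proof.
move=> um su t tu tF; rewrite inE (sub_max_face um tu) tF /=.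
by apply: (sub_max_face um); rewrite subUset tu su.
Qed.

Lemma maxfaces_link (m : {set V} -> R) :
  maxfaces (WComplex (link_faces F s) m) = [set t in link_faces F s | #|t| == #|F|].
Proof.
apply/setP=> t; rewrite !inE /=; apply/maxsetP/andP => [[]|[tA /eqP tF]].
  move=> tA maxt; split; first by move: tA; rewrite inE.
  move: tA; rewrite inE => /and3P[tX tF /face_sub_max[u um]].
  rewrite subUset => /andP[tu su].
  rewrite -(maxt (cpart F u)) ?card_cpart //.
    by apply: (max_link_faces um su); rewrite ?cpart_sub ?col_cpart.
  apply/subsetP=> v vt; rewrite inE (subsetP tu) //= (subsetP tF) //.
  exact: imset_f.
split; first by rewrite inE.
move=> t'; rewrite inE => /and3P[t'X t'F _] tt'.
apply/esym/eqP; rewrite eqEcard tt' /= tF -card_col //.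
exact: subset_leq_card.
Qed.

Lemma sum_top_link (P : pred {set V}) : 
  \sum_(r in maxfaces Y | P r) mass X (r :|: s) =
  \sum_(u in maxfaces X | s \subset u) weight X u * (P (cpart F u))%:R.
Proof.
rewrite /Y maxfaces_link.
rewrite (eq_bigl (fun r => (r \in link_faces F s) && ((#|r| == #|F|) && P r))).
  rewrite sum_link_mass; apply: eq_bigr => u um; congr (_ * _).
  rewrite (big_pred1 F) // => S /=.
  apply/andP/eqP => [[SF /eqP eS]|->]; last by rewrite eqxx.
  by apply/eqP; rewrite eqEcard SF eS leqnn.
by move=> r; rewrite inE /= andbA.
Qed.

(** Each maximal face of X containing [s] determines one top face of the link, its part with colors
    in F. Hence the normalizing constant of the link is [mass X s]. *)
Lemma mass_link t : t \in link_faces F s -> mass Y t = mass X (t :|: s) / mass X s.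
Proof.
move=> tA; rewrite {1}/mass /= -mulr_suml.
have -> : \sum_(u in maxfaces (WComplex (link_faces F s) (fun t => mass X (t :|: s))))
   mass X (u :|: s) = mass X s.
  rewrite maxfaces_link -(maxfaces_link (weight Y)).
  have := sum_top_link xpredT; under eq_bigl => r do rewrite andbT.
  move=> ->; apply: eq_bigr => u _; by rewrite mulr1.
congr (_ / _); rewrite sum_top_link /mass [LHS]big_mkcond [RHS]big_mkcond /=.
apply: eq_bigr => u _; rewrite subUset; case: (u \in _) => //=.
rewrite andbC; case: (s \subset u) => //=.
have -> : t \subset cpart F u = (t \subset u).
  apply/idP/idP => [tu|tu]; first exact: subset_trans tu (cpart_sub _ _).
  apply/subsetP => v vt; rewrite inE (subsetP tu) //=.
  move: tA; rewrite inE => /and3P[_ /subsetP tF _]; apply: tF; exact: imset_f.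
by case: ifP; rewrite ?mulr1 ?mulr0.
Qed.

Lemma rank_link : rank Y = #|F|.
Proof.
apply/eqP; rewrite eqn_leq; apply/andP; split.
  apply/bigmax_leqP => t; rewrite inE => /and3P[tX tF _].
  by rewrite -card_col //; apply: subset_leq_card.
have [u um su] := face_sub_max sX.
rewrite -(card_cpart F um) /rank.
apply: (@leq_bigmax_cond _ (mem (faces Y)) (fun t : {set V} => #|t|)).
by apply: (max_link_faces um su); rewrite ?cpart_sub ?col_cpart.
Qed.

Lemma Pr_link n (P : pred {set V}) :
  Pr Y n P = ('C(#|F|, n)%:R * mass X s)^-1 *
   \sum_(u in maxfaces X | s \subset u) weight X u *
    \sum_(S : {set 'I_d} | (S \subset F) && (#|S| == n)) (P (cpart S u))%:R.
Proof.
rewrite -sum_link_mass mulr_sumr /Pr.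
rewrite (eq_bigl (fun r => (r \in link_faces F s) && ((#|r| == n) && P r))); last first.
  by move=> r; rewrite inE /= andbA.
apply: eq_bigr => r /and3P[rA /eqP rn _].
by rewrite /level_pr rank_link rn mass_link // invfM -mulrA [X in _ = _ * X]mulrC.
Qed.

End Link.


Lemma rankX : rank X = d.
Proof.
apply/eqP; rewrite eqn_leq; apply/andP; split.
  apply/bigmax_leqP => t tX; rewrite -card_col //.
  by rewrite -[leqRHS]card_ord; apply: max_card.
have [u um _] := face_sub_max face0.
rewrite -(faces_pure hX um).
exact: (@leq_bigmax_cond _ (mem (faces X)) (fun t : {set V} => #|t|) _ (max_face um)).
Qed.

Lemma Pr_X n (P : pred {set V}) :
  Pr X n P = 'C(d, n)%:R^-1 * \sum_(S : {set 'I_d} | #|S| == n) 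
    \sum_(u in maxfaces X) weight X u * (P (cpart S u))%:R.
Proof.
rewrite exchange_big /= /Pr.
transitivity ('C(d, n)%:R^-1 * \sum_(r in link_faces setT set0 | (#|r| == n) && P r) mass X (r :|: set0)).
  rewrite mulr_sumr; apply: eq_big => [r|r].
    by rewrite !inE subsetT setU0 /= andbb andbA.
  by rewrite inE => /andP[/andP[_ /eqP rn] _]; rewrite /level_pr rankX rn setU0.
rewrite sum_link_mass; congr (_ * _); apply: eq_big => [u|u _]; first by rewrite sub0set andbT.
by rewrite mulr_sumr; apply: eq_bigl => S; rewrite subsetT.
Qed.

End Complex.

(** * Expansion as an existence statement *)

Section Expansion.
Variables (R : realType) (V : finType) (G : groupType) (Y : wcomplex R V).

Definition disagree n (f g : n.-tuple V -> G) (s : {set V}) : bool :=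
  [exists t : n.-tuple V, ([set v in t] == s) && (f t != g t)].

Lemma eq_disagree n (f g h : n.-tuple V -> G) s :
  (forall t : n.-tuple V, [set v in t] = s -> g t = h t) ->
  disagree f g s = disagree f h s.
Proof.
move=> e; apply: eq_existsb => t; have [st|//] := eqVneq [set v in t] s.
by rewrite e.
Qed.

Lemma disagreeN n (f g : n.-tuple V -> G) s :
  reflect (forall t : n.-tuple V, [set v in t] = s -> f t = g t)
    (~~ disagree f g s).
Proof.
rewrite negb_exists; apply: (iffP forallP) => [h t st|h t].
  by have := h t; rewrite st eqxx negbK => /eqP.
have [st|//] := eqVneq [set v in t] s.
by rewrite h // eqxx.
Qed.

Lemma uniq_card_tuple n (t : n.-tuple V) : uniq t = (#|[set v in t]| == n).
Proof.
rewrite cardsE; apply/idP/idP => [/card_uniqP->|/eqP e]; first by rewrite size_tuple.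
by apply/card_uniqP; rewrite e size_tuple.
Qed.

Lemma oface_level n (t : n.-tuple V) : oface Y t = ([set v in t] \in level Y n).
Proof. by rewrite inE andbC -uniq_card_tuple. Qed.

Lemma set_tuple_perm n (t : n.-tuple V) (pi : 'S_n) :
  [set v in [tuple tnth t (pi i) | i < n]] = [set v in t].
Proof.
apply/setP=> v; rewrite !inE; apply/tnthP/tnthP => -[i ->].
  by rewrite tnth_mktuple; exists (pi i).
by exists ((pi^-1)%g i); rewrite tnth_mktuple permKV.
Qed.

Lemma eq_Pr n (P Q : pred {set V}) :
  {in level Y n, P =1 Q} -> Pr Y n P = Pr Y n Q.
Proof.
move=> e; apply: eq_bigl => s; have [sY|//] := boolP (s \in level Y n).
exact: e.
Qed.

Hypothesis pr_ge0 : forall s, s \in faces Y -> 0 <= level_pr Y s.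

Lemma Pr_ge0 n P : 0 <= Pr Y n P.
Proof. by apply: sumr_ge0 => s /andP[]; rewrite inE => /andP[/pr_ge0]. Qed.

(** The group may be infinite, but a distance depends only on the set of faces where two cochains
    disagree. There are finitely many such sets, so the infimum is attained. *)
Lemma dist_coboundaries_min n (f : n.+1.-tuple V -> G) :
  exists2 h : n.-tuple V -> G, cochains Y h &
    dist_coboundaries Y f = Pr Y n.+1 (disagree f (cobd h)).
Proof.
pose D (g : n.+1.-tuple V -> G) := [set s in level Y n.+1 | disagree f g s].
pose Q (A : {set {set V}}) := `[< exists2 g, coboundaries Y g & A = D g >].
pose pr (A : {set {set V}}) := \sum_(s in A) level_pr Y s.
have distE g : dist Y f g = pr (D g) by rewrite /pr; apply: eq_bigl => s; rewrite !inE.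
have cob1 : coboundaries Y (@cobd V G n (fun _ => 1%g)).
  by exists (fun _ => 1%g) => // t pi _; rewrite invg1 if_same.
have Q1 : Q (D (cobd (fun _ => 1%g))) by apply/asboolP; exists (cobd (fun _ => 1%g)).
case: (@Order.TotalTheory.arg_minP _ _ _ _ Q pr Q1) => A /asboolP[g [h hY gh] ->] minA.
exists h => //.
have -> : Pr Y n.+1 (disagree f (cobd h)) = dist Y f g.
  apply: eq_Pr => s sY; apply: eq_disagree => t st.
  by rewrite gh // oface_level st.
have cg : coboundaries Y g by exists h.
apply/eqP; rewrite eq_le; apply/andP; split.
  apply: ge_inf; last by exists g.
  by exists 0 => _ [g' _ ->]; apply: Pr_ge0.
apply: lb_le_inf; first by exists (dist Y f g), g.
move=> _ [g' cg' ->]; rewrite !distE; apply: minA; apply/asboolP; by exists g'.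
Qed.

Lemma expanding_elim n (beta : R) : 0 < beta ->
  coboundary_expanding G Y n.+1 beta ->
  forall f : n.+1.-tuple V -> G, cochains Y f ->
  exists2 h : n.-tuple V -> G, cochains Y h &
    beta * Pr Y n.+1 (disagree f (cobd h)) <=
    Pr Y n.+2 (disagree (cobd f) (fun _ => 1%g)).
Proof.
move=> b0 [_ hb] f cf.
have [[h ch fh]|nf] := pselect (coboundaries Y f).
  exists h => //; rewrite [X in beta * X](_ : _ = 0) ?mulr0 ?Pr_ge0 //.
  apply: big1 => s /andP[sY /existsP[t /andP[/eqP st]]].
  by rewrite fh ?eqxx // oface_level st.
have [h ch dh] := dist_coboundaries_min f; exists h => //.
have /(le_trans hb) : (expansion G Y n.+1 <=
    (wt Y (cobd f) / dist_coboundaries Y f)%:E)%E.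
  by apply: ereal_inf_lbound; exists f.
rewrite lee_fin dh.
(* At distance zero the ratio in [expansion] divides by zero, but the claimed inequality is then
   trivial. *)
have [->|d0] := eqVneq (Pr Y n.+1 (disagree f (cobd h))) 0.
  by rewrite mulr0 Pr_ge0.
by rewrite ler_pdivlMr // lt_def d0 Pr_ge0.
Qed.

(** All faces have positive probability, so a cochain at distance zero from a coboundary equals it
    on ordered faces. The last hypothesis, applied to a cocycle, therefore makes it a coboundary,
    and for other cochains the denominator of the ratio is positive. *)
Lemma expanding_intro n (beta : R) : 0 < beta ->
  {in level Y n.+1, forall s, 0 < level_pr Y s} ->
  (forall h : n.-tuple V -> G, cochains Y h -> cochains Y (cobd h)) ->
  (forall h : n.-tuple V -> G, cochains Y h ->
    forall f : n.+1.-tuple V -> G, (forall t, oface Y t -> f t = cobd h t) ->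
    forall t, oface Y t -> cobd f t = 1%g) ->
  (forall f : n.+1.-tuple V -> G, cochains Y f ->
  exists2 h : n.-tuple V -> G, cochains Y h &
    beta * Pr Y n.+1 (disagree f (cobd h)) <=
    Pr Y n.+2 (disagree (cobd f) (fun _ => 1%g))) ->
  coboundary_expanding G Y n.+1 beta.
Proof.
move=> b0 pr_gt0 cobd_cochain cobd_cobd hexp.
have Pr0 (f g : n.+1.-tuple V -> G) : Pr Y n.+1 (disagree f g) <= 0 -> forall t, oface Y t -> f t = g t.
  move=> e t tY; apply/eqP/negPn/negP => ft.
  have : 0 < Pr Y n.+1 (disagree f g).
    rewrite /Pr (bigD1 [set v in t]) /=; last first.
      by rewrite -oface_level tY; apply/existsP; exists t; rewrite eqxx.
    apply: ltr_wpDr; last by apply: pr_gt0; rewrite -oface_level.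
    by apply: sumr_ge0 => s /andP[/andP[sY _] _]; apply/ltW/pr_gt0.
  by rewrite ltNge e.
split.
  apply/seteqP; split=> f /=.
    move=> [cf zf]; have [h ch] := hexp f cf.
    have -> : Pr Y n.+2 (disagree (cobd f) (fun _ => 1%g)) = 0.
      apply: big1 => s /andP[sY /existsP[t /andP[/eqP st]]].
      by rewrite zf ?eqxx // oface_level st.
    by rewrite pmulr_rle0 // => /Pr0 e; exists h.
  move=> [h ch fh]; split; last by apply: cobd_cobd ch f fh.
  move=> t pi tY; rewrite (fh t) // fh; first exact: cobd_cochain.
  by rewrite oface_level set_tuple_perm -oface_level.
apply: le_ereal_inf_tmp => _ [f [cf nf ->]].
rewrite lee_fin; have [h' ch' dh'] := dist_coboundaries_min f.
rewrite ler_pdivlMr.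
  have [h ch hb] := hexp f cf; apply: le_trans hb.
  rewrite ler_pM2l //; apply: ge_inf.
    by exists 0 => _ [g' _ ->]; apply: Pr_ge0.
  by exists (cobd h) => //; exists h.
by rewrite dh' ltNge; apply/negP => /Pr0 e; apply: nf; exists h'.
Qed.

End Expansion.

(** * Averages over sets of colors *)

Section Layers.
Variables (R : realFieldType) (d : nat).
Implicit Types (F U : {set 'I_d}) (h : {set 'I_d} -> R).

Definition layer F n j U : bool := (#|U| == n) && (#|U :\: F| == j).

Definition layer_sum F n j h : R := \sum_(U | layer F n j U) h U.

Lemma card_layer F n j : (j <= n)%N ->
  #|[set U | layer F n j U]| = ('C(#|F|, n - j) * 'C(d - #|F|, j))%N.
Proof.
move=> jn; have cF : (d - #|F| = #|~: F|)%N by rewrite [RHS]cardsCs setCK card_ord.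
rewrite cF -!cards_draws -cardsX.
rewrite -(card_in_imset (f := fun AB : {set 'I_d} * {set 'I_d} => AB.1 :|: AB.2)).
  apply: eq_card => U; rewrite inE; apply/andP/imsetP => [[/eqP Un /eqP Uj]|].
    exists (U :&: F, U :\: F); last by rewrite setID.
    rewrite !inE subsetIr Uj eqxx andbT /= -Un -Uj -[X in (X - _)%N](cardsID F U).
    by rewrite addnK eqxx /= setDE subsetIr.
  move=> [[A B]]; rewrite !inE /= => /andP[/andP[AF /eqP An] /andP[BF /eqP Bj]] ->.
  have DAB : [disjoint A & B].
    by rewrite disjoint_sym disjoints_subset (subset_trans BF) // setCS.
  have DBF : [disjoint B & F] by rewrite disjoints_subset.
  rewrite cardsU (disjoint_setI0 DAB) cards0 subn0 An Bj subnK // eqxx.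
  rewrite setDUl (setDidPl DBF).
  by move: AF; rewrite -setD_eq0 => /eqP->; rewrite set0U Bj.
move=> [A B] [A' B']; rewrite !inE /=.
move=> /andP[/andP[AF _] /andP[BF _]] /andP[/andP[AF' _] /andP[BF' _]] e.
have eA (C D : {set 'I_d}) : C \subset F -> D \subset ~: F -> (C :|: D) :&: F = C.
  move=> CF DF; rewrite setIUl (setIidPl CF).
  by move: DF; rewrite -disjoints_subset => /disjoint_setI0 ->; rewrite setU0.
have eB (C D : {set 'I_d}) : C \subset F -> D \subset ~: F -> (C :|: D) :&: ~: F = D.
  move=> CF DF; rewrite setIUl (setIidPl DF) -setDE.
  by move: CF; rewrite -setD_eq0 => /eqP->; rewrite set0U.
by rewrite -(eA A B) // -{2}(eB A B) // e eA // eB.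
Qed.

Lemma layer_sum_eq0 F n j h : (d - #|F| < j)%N -> layer_sum F n j h = 0.
Proof.
move=> jF; apply: big_pred0 => U; apply/negP => /andP[_ /eqP Uj].
move: jF; rewrite -Uj ltnNge => /negP; apply.
have -> : (d - #|F| = #|~: F|)%N by rewrite [RHS]cardsCs setCK card_ord.
by apply: subset_leq_card; rewrite setDE subsetIr.
Qed.

Lemma sum_layers F n h :
  \sum_(U : {set 'I_d} | #|U| == n) h U = \sum_(j < n.+1) layer_sum F n j h.
Proof.
rewrite (partition_big (fun U : {set 'I_d} => inord #|U :\: F| : 'I_n.+1) xpredT) //=.
apply: eq_bigr => j _; apply: eq_bigl => U; rewrite /layer.
have [/eqP Un|//] := boolP (#|U| == n); rewrite /=.
rewrite -(inj_eq val_inj) /= inordK // ltnS -Un.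
by apply: subset_leq_card; rewrite subsetDl.
Qed.

(** A set of [layer F n j] is obtained once for each color lying neither in it nor in F, and there
    are d - |F| - j of these. *)
Lemma sum_layer_remove F n j h :
  \sum_(U | layer F n.+1 j.+1 U) \sum_(i in U :\: F) h (U :\ i) =
  (d - #|F| - j)%:R * layer_sum F n j h.
Proof.
rewrite (exchange_big_dep (fun i => i \notin F)) /=; last first.
  by move=> U i _; rewrite inE => /andP[].
transitivity (\sum_(i | i \notin F) \sum_(U | layer F n j U && (i \notin U)) h U).
  apply: eq_bigr => i iF.
  rewrite (reindex_onto (fun U => i |: U) (fun U => U :\ i)) /=; last first.
    by move=> U /andP[_]; rewrite inE => /andP[_]; apply: setD1K.
  apply: eq_big => [U|U].
    rewrite !inE eqxx iF andbT.
    have [iU|iU] := boolP (i \in U).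
      rewrite !andbF; apply/negP=> /andP[_ /eqP e].
      by move: iU; rewrite -e setD11.
    rewrite setU1K // eqxx !andbT /layer cardsU1 iU eqSS; congr (_ && _).
    rewrite setDUl (setDidPl _); last by rewrite disjoints1.
    by rewrite cardsU1 inE (negPf iU) andbF add1n eqSS.
  move=> /andP[_ /eqP ->] //.
rewrite (exchange_big_dep (layer F n j)) /=; last by move=> i U _ /andP[].
rewrite mulr_sumr; apply: eq_bigr => U UL; have /andP[_ /eqP Uj] := UL.
rewrite (eq_bigl (mem (~: (F :|: U)))); last first.
  move=> i; by rewrite !inE negb_or UL.
rewrite sumr_const mulr_natl; congr (_ *+ _).
have := cardsC (F :|: U); rewrite card_ord.
have := subset_leq_card (subsetIr F U).
rewrite cardsU -Uj cardsD [U :&: F]setIC.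
move: #|U| #|F| #|F :&: U| #|~: _| => a b x y; lia.
Qed.


(* Both sides count the pairs (F, U) with #|F| = l, #|U| = n and
   #|U :\: F| = j, each side for constant weights. *)
Lemma average_layer_sum l n j h : (forall U, 0 <= h U) ->
  (j <= n)%N -> (n - j <= l)%N -> (l <= d)%N ->
  \sum_(F : {set 'I_d} | #|F| == l)
    layer_sum F n j h / ('C(l, n - j) * 'C(d - l, j))%:R <=
  'C(d, l)%:R * ('C(d, n)%:R^-1 * \sum_(U : {set 'I_d} | #|U| == n) h U).
Proof.
move=> h0 jn jl ld.
have S0 : 0 <= \sum_(U : {set 'I_d} | #|U| == n) h U by apply: sumr_ge0.
have [e|Cj] := posnP 'C(d - l, j).
  rewrite big1 => [|F _]; last by rewrite e muln0 invr0 mulr0.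
  by rewrite !mulr_ge0 ?invr_ge0.
pose N := ('C(n, n - j) * 'C(d - n, l - (n - j)))%N.
have swap F U : #|F| = l -> #|U| = n -> layer F n j U = layer U l (l - (n - j))%N F.
  move=> cF cU; rewrite /layer cF cU !eqxx /= !cardsD cF cU [F :&: U]setIC.
  have := subset_leq_card (subsetIl U F); have := subset_leq_card (subsetIr U F).
  by rewrite cF cU; lia.
have sumE (g : {set 'I_d} -> R) : \sum_(F : {set 'I_d} | #|F| == l) layer_sum F n j g =
    N%:R * \sum_(U : {set 'I_d} | #|U| == n) g U.
  rewrite /layer_sum (exchange_big_dep (fun U : {set 'I_d} => #|U| == n)) /=; last first.
    by move=> F U _ /andP[].
  rewrite mulr_sumr; apply: eq_bigr => U /eqP cU.
  rewrite (eq_bigl (mem [set F | layer U l (l - (n - j))%N F])).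
    rewrite sumr_const mulr_natl card_layer ?leq_subr // cU subKn //.
  move=> F; rewrite [RHS]inE; have [/eqP cF|cF] := boolP (#|F| == l).
    by rewrite (swap F U cF cU).
  by rewrite /layer (negPf cF).
have draws m (x : R) : \sum_(B : {set 'I_d} | #|B| == m) x = 'C(d, m)%:R * x.
  have := @card_draws 'I_d m; rewrite card_ord => <-.
  rewrite mulr_natl -sumr_const.
  by apply: eq_bigl => B; rewrite inE.
have := sumE (fun _ => 1); rewrite draws mulr1.
rewrite (eq_bigr (fun _ => ('C(l, n - j) * 'C(d - l, j))%:R)); last first.
  move=> F /eqP cF; rewrite /layer_sum -cF -card_layer // -sumr_const.
  by apply: eq_bigl => U; rewrite inE.
rewrite draws => key.
have Cl : (0 < 'C(l, n - j))%N by rewrite bin_gt0.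
have nd : (n <= d)%N by move: Cj; rewrite bin_gt0; lia.
rewrite -mulr_suml sumE mulrA.
rewrite ler_pdivrMr ?ltr0n ?muln_gt0 ?Cl //.
rewrite mulrAC; apply: ler_wpM2r => //.
rewrite mulrAC key mulrK ?unitfE ?pnatr_eq0 -?lt0n ?bin_gt0 //.
Qed.

(** The majorant of E_j obtained by unfolding the recursion once all factors beta are moved to the
    side of E_j. *)
Fixpoint rec_bound (D : nat -> R) j : R :=
  if j is i.+1 then D i.+1 + i.+1%:R * rec_bound D i else D 0.

Lemma rec_bound_ge0 (D : nat -> R) j : (forall i, 0 <= D i) -> 0 <= rec_bound D j.
Proof. by move=> D0; elim: j => //= i IH; rewrite addr_ge0 // mulr_ge0. Qed.

(** The induction rests on (j + 2)! = (j + 1)! + (j + 1) (j + 1)!, whose first term absorbs the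
    contribution of [D]. At j = k + 1 this is the origin of (k + 2)!. *)
Lemma sum_rec_bound_le (I : finType) (P : pred I) (D : I -> nat -> R) (n : nat) (M : R) :
  0 <= M -> (forall j, (j <= n)%N -> \sum_(i | P i) D i j <= M) ->
  forall j, (j <= n)%N -> \sum_(i | P i) rec_bound (D i) j <= (j.+1)`!%:R * M.
Proof.
move=> M0 DM; elim=> [|j IH] jn; first by rewrite mul1r; apply: DM.
rewrite big_split /= -mulr_sumr.
apply: le_trans (lerD (DM _ jn) (ler_wpM2l (ler0n _ _) (IH (ltnW jn)))) _.
rewrite mulrA -{1}[M]mul1r -mulrDl -natrM nat1r; apply: ler_wpM2r => //.
by rewrite ler_nat [leqRHS]factS mulSn -add1n leq_add2r fact_gt0.
Qed.

(** * The recursion on the number of colors outside F *)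

Section LayerRecursion.
Variables (l k : nat) (H : {set 'I_d} -> R).
Hypotheses (kl : (k + 2 <= l)%N) (ld : (l <= d)%N).
Hypothesis H_ge0 : forall U, 0 <= H U.

(** For |F| = l this is the mean of [H] over the layer, the D_j of the recursion. An empty layer
    gets the value 0. *)
Definition layer_density F j : R :=
  layer_sum F k.+2 j H / ('C(l, k.+2 - j) * 'C(d - l, j))%:R.

Lemma layer_density_ge0 F j : 0 <= layer_density F j.
Proof. by rewrite divr_ge0 ?ler0n ?sumr_ge0. Qed.

(** The binomial product is the number of color sets of size k + 1 with j colors outside F, so the
    sum majorizes a total over all color sets of size k + 1. *)
Definition total_bound F : R := \sum_(j < k.+2)
  ('C(l, k.+1 - j) * 'C(d - l, j))%:R * rec_bound (layer_density F) j.

Lemma total_bound_ge0 F : 0 <= total_bound F.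
Proof.
apply: sumr_ge0 => j _; rewrite mulr_ge0 // rec_bound_ge0 //.
exact: layer_density_ge0.
Qed.

Lemma sum_total_bound :
  \sum_(F : {set 'I_d} | #|F| == l) total_bound F <=
  'C(d, k.+1)%:R * (k.+2)`!%:R * ('C(d, l)%:R *
    ('C(d, k.+2)%:R^-1 * \sum_(U : {set 'I_d} | #|U| == k.+2) H U)).
Proof.
set M := 'C(d, l)%:R * _.
have M0 : 0 <= M by rewrite !mulr_ge0 ?invr_ge0 ?sumr_ge0.
(* Vandermonde splits the count of (k + 1)-sets by the number j of colors outside F, which matches
   the weights in [total_bound] term by term. *)
have -> : 'C(d, k.+1)%:R = \sum_(j < k.+2) ('C(d - l, j) * 'C(l, k.+1 - j))%:R :> R.
  by rewrite -natr_sum binomial.Vandermonde subnK.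
rewrite exchange_big /= !mulr_suml.
apply: ler_sum => j _; rewrite -mulr_sumr [X in X%:R * _]mulnC -mulrA.
apply: ler_wpM2l => //.
have jk : (j <= k.+1)%N by rewrite -ltnS.
apply: le_trans (sum_rec_bound_le M0 _ jk) _ => [i ik|].
  by apply: average_layer_sum => //; lia.
apply: ler_wpM2r => //; rewrite ler_nat; exact: leq_fact.
Qed.

Variable beta : R.
Hypotheses (beta_gt0 : 0 < beta) (beta_le1 : beta <= 1).

(** In terms of the means E_j of [h] and D_j of [H] over layers this reads beta E_j <= D_j + j
    E_(j-1), because (d - l - i) C(d - l, i) = (i + 1) C(d - l, i + 1). Sums with binomial factors
    avoid dividing by the size of an empty layer. *)
Definition layer_recursion F h : Prop := forall j, (j <= k.+1)%N ->
  (if (j <= k)%N then beta else 1) * 'C(l, k.+2 - j)%:R * layer_sum F k.+1 j h <=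
  'C(l, k.+1 - j)%:R * (layer_sum F k.+2 j H +
     if j is i.+1 then (d - l - i)%:R * layer_sum F k.+1 i h else 0).

Lemma layer_recursion_bound F h : #|F| = l -> (forall U, 0 <= h U) ->
  layer_recursion F h -> forall j, (j <= k.+1)%N ->
  beta ^+ k.+1 * layer_sum F k.+1 j h <=
  ('C(l, k.+1 - j) * 'C(d - l, j))%:R * rec_bound (layer_density F) j.
Proof.
move=> cF h0 rec j jk.
have ls0 n i g : (forall U, 0 <= g U) -> 0 <= layer_sum F n i g.
  by move=> g0; apply: sumr_ge0.
have HE i : layer_sum F k.+2 i H =
    ('C(l, k.+2 - i) * 'C(d - l, i))%:R * layer_density F i \/ (d - l < i)%N.
  have [e|i0] := ltnP (d - l) i; [by right|left].
  rewrite /layer_density mulrC divfK // pnatr_eq0 -lt0n muln_gt0 !bin_gt0 i0 andbT.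
  by rewrite (leq_trans (leq_subr _ _)) // -addn2.
(* The exponent counts the levels up to j that lose a factor beta; level k + 1 loses none, hence the
   minimum. *)
suff {j jk} claim j : (j <= k.+1)%N -> beta ^+ minn j.+1 k.+1 * layer_sum F k.+1 j h <=
  ('C(l, k.+1 - j) * 'C(d - l, j))%:R * rec_bound (layer_density F) j.
  apply: le_trans (claim j jk); apply: ler_wpM2r; first exact: ls0.
  by apply: ler_wiXn2l (geq_minr _ _) => //; apply: ltW.
elim: j => [|i IH] jk.
  have := rec 0%N isT; rewrite /= !subn0 addr0 minnE subSS subn0 => r.
  have [e|//] := HE 0%N.
  have C0 : 0 < ('C(l, k.+2))%:R :> R by rewrite ltr0n bin_gt0 -addn2.
  rewrite -(ler_pM2r C0) expr1 mulrAC; apply: le_trans r _.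
  by rewrite e subn0 !natrM le_eqVlt; apply/orP; left; apply/eqP; ring.
have {IH} := IH (ltnW jk); have := rec _ jk.
have [e|si] := HE i.+1; last first.
  move=> _ _; rewrite layer_sum_eq0 ?cF // mulr0 mulr_ge0 // rec_bound_ge0 //.
  exact: layer_density_ge0.
rewrite (minn_idPl jk) e /= !subSS => r IH.
set b := beta ^+ i.+1 in IH; set E := layer_sum F k.+1 i.+1 h in r *.
have C0 : 0 < ('C(l, k.+1 - i))%:R :> R by rewrite ltr0n bin_gt0; lia.
have b0 : 0 < b by apply: exprn_gt0.
have b1 : b <= 1 by apply: exprn_ile1 => //; apply: ltW.
have bE : beta ^+ minn i.+2 k.+1 = b * (if (i < k)%N then beta else 1).
  case: ltnP => ik; first by rewrite (minn_idPl _) // exprSr.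
  by rewrite mulr1 (_ : minn i.+2 k.+1 = i.+1) //; lia.
rewrite -(ler_pM2r C0) bE.
have {r} := ler_wpM2l (ltW b0) r.
set x := (if _ then _ else _).
rewrite (_ : b * (x * 'C(l, k.+1 - i)%:R * E) = b * x * E * 'C(l, k.+1 - i)%:R); last by ring.
move=> r; apply: le_trans r _.
set D := layer_density F i.+1; set B := rec_bound _ i in IH *.
have D0 : 0 <= D by apply: layer_density_ge0.
have bin : ((d - l - i) * 'C(d - l, i) = i.+1 * 'C(d - l, i.+1))%N by rewrite mul_bin_left.
have binR : (d - l - i)%:R * 'C(d - l, i)%:R = i.+1%:R * 'C(d - l, i.+1)%:R :> R.
  by rewrite -!natrM bin.
have T2 : b * ((d - l - i)%:R * layer_sum F k.+1 i h) <=
    'C(l, k.+1 - i)%:R * 'C(d - l, i.+1)%:R * (i.+1%:R * B).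
  rewrite mulrCA; apply: le_trans (ler_wpM2l (ler0n _ _) IH) _.
  rewrite natrM; move: binR.
  move: (d - l - i)%:R 'C(d - l, i)%:R 'C(l, k.+1 - i)%:R => u v w binR.
  rewrite (_ : u * (w * v * B) = w * (u * v) * B); last by ring.
  rewrite binR -subr_ge0 (_ : _ - _ = 0) //; ring.
have T1 : b * (('C(l, k.+1 - i) * 'C(d - l, i.+1))%:R * D) <= 'C(l, k.+1 - i)%:R * 'C(d - l, i.+1)%:R * D.
  by rewrite -natrM; apply: ler_piMl => //; apply: mulr_ge0.
rewrite mulrCA mulrDr.
apply: le_trans (ler_wpM2l (ler0n _ _) (lerD T1 T2)) _.
by rewrite natrM le_eqVlt; apply/orP; left; apply/eqP; ring.
Qed.

Lemma layer_recursion_total F h : #|F| = l -> (forall U, 0 <= h U) ->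
  layer_recursion F h ->
  beta ^+ k.+1 * \sum_(U : {set 'I_d} | #|U| == k.+1) h U <= total_bound F.
Proof.
move=> cF h0 rec; rewrite (sum_layers F) mulr_sumr; apply: ler_sum => j _.
by apply: layer_recursion_bound; rewrite // -ltnS.
Qed.

End LayerRecursion.

(** Otherwise [p * Phi F] exceeds [M] on every good set. There are at least p C(d, l) good sets, and
    dropping the others only decreases the sum of [Phi], so that sum would exceed C(d, l) M. *)
Lemma exists_below_average l (good : pred {set 'I_d}) (Phi : {set 'I_d} -> R) p M :
  (forall F, 0 <= Phi F) -> 0 <= M -> 0 < p -> (l <= d)%N ->
  p <= #|[set F : {set 'I_d} | (#|F| == l) && good F]|%:R / 'C(d, l)%:R ->
  \sum_(F : {set 'I_d} | #|F| == l) Phi F <= 'C(d, l)%:R * M ->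
  exists F : {set 'I_d}, [/\ #|F| = l, good F & p * Phi F <= M].
Proof.
move=> Phi0 M0 p0 ld; set A := [set F | _].
have C0 : 0 < 'C(d, l)%:R :> R by rewrite ltr0n bin_gt0.
rewrite ler_pdivlMr // => pA sumPhi.
have [/existsP[F /and3P[/eqP cF gF pF]]|] :=
    boolP [exists F : {set 'I_d}, [&& #|F| == l, good F & p * Phi F <= M]].
  by exists F.
rewrite negb_exists => /forallP nF.
have A0 : (0 < #|A|)%N by rewrite -(ltr0n R); apply: lt_le_trans pA; apply: mulr_gt0.
have [F0 F0A] := card_gt0P A0.
have lt1 : \sum_(F in A) M < \sum_(F in A) p * Phi F.
  apply: ltr_sum; first by apply/hasP; exists F0; rewrite ?mem_index_enum.
  by move=> F; rewrite inE => /andP[cF gF]; have := nF F; rewrite cF gF /= -ltNge.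
have le2 : \sum_(F in A) p * Phi F <= p * ('C(d, l)%:R * M).
  rewrite -mulr_sumr ler_pM2l //; apply: le_trans sumPhi.
  rewrite [leRHS](bigID good) /= [leLHS](eq_bigl (fun F : {set 'I_d} => (#|F| == l) && good F)).
    by rewrite lerDl sumr_ge0.
  by move=> F; rewrite inE.
have := lt_le_trans lt1 le2.
rewrite sumr_const -[M *+ _]mulr_natl mulrA ltNge => /negP; case.
exact: ler_wpM2r.
Qed.

End Layers.

(** * Distributions on faces by color *)

Section ColorSums.
Variables (R : realType) (V : finType) (d : nat).
Variables (X : wcomplex R V) (c : V -> 'I_d).
Hypothesis hX : partite_complex X c.
Variable F : {set 'I_d}.
Implicit Types (s t r u : {set V}) (S U : {set 'I_d}).

Definition color_avg (p : {set V} -> R) U : R :=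
  \sum_(u in maxfaces X) weight X u * p (cpart c U u).

(** Up to the factor ['C(#|F|, n) * mass X s] of [Pr_link], this is the mean of [p] on s ∪ r for a
    random face [r] with n vertices in the link of [s]. Without normalization these sums can be
    added over [s]. *)
Definition star_sum n s (p : {set V} -> R) : R :=
  \sum_(u in maxfaces X | s \subset u) weight X u *
    \sum_(S : {set 'I_d} | (S \subset F) && (#|S| == n)) p (s :|: cpart c S u).

Lemma cpartU S U u : cpart c (S :|: U) u = cpart c S u :|: cpart c U u.
Proof. by apply/setP=> v; rewrite !inE -andb_orr. Qed.

Lemma cpartD1 U u v : u \in maxfaces X -> v \in cpart c U u ->
  cpart c (U :\ c v) u = cpart c U u :\ v.
Proof.
move=> um; rewrite inE => /andP[vu _]; apply/setP=> w; rewrite !inE.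
have [wu|] := boolP (w \in u); last by rewrite andbF.
by rewrite (inj_in_eq (col_inj_max hX um)).
Qed.

Definition outside u : {set V} := cpart c (~: F) u.

Lemma outside_id s : [disjoint col c s & F] -> outside s = s.
Proof.
move=> sF; apply/setP=> v; rewrite !inE; case: (boolP (v \in s)) => //= vs.
by apply/negP => /(disjointFl sF); rewrite imset_f.
Qed.

Lemma outside0 r : col c r \subset F -> outside r = set0.
Proof.
move=> rF; apply/setP=> v; rewrite !inE; apply/negP => /andP[vr /negP]; apply.
by apply: (subsetP rF); apply: imset_f.
Qed.

Lemma outsideU s r : outside (s :|: r) = outside s :|: outside r.
Proof. by apply/setP=> v; rewrite !inE andb_orl. Qed.

(** Inside a maximal face, a face [s] with j colors outside F and a set [S] of n colors in F amount
    to one color set U, with U \ F the colors of [s] and U ∩ F = S. *)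
Lemma sum_star_sum n j p :
  \sum_(s in level X j | [disjoint col c s & F]) star_sum n s p =
  layer_sum F (n + j)%N j (color_avg p).
Proof.
rewrite /layer_sum /color_avg [RHS]exchange_big /= /star_sum.
rewrite (exchange_big_dep (mem (maxfaces X))) /=; last by move=> s u _ /andP[].
apply: eq_bigr => u um; rewrite -!mulr_sumr; congr (_ * _).
rewrite (reindex_onto (cpart c ^~ u) (col c)) /=; last first.
  by move=> s /andP[_ /andP[_ su]]; apply: (cpart_col hX).
rewrite (eq_bigl (fun T : {set 'I_d} => (T \subset ~: F) && (#|T| == j))); last first.
  move=> T; rewrite (col_cpart hX) // eqxx um cpart_sub !andbT inE (card_cpart hX) //.
  by rewrite (sub_max_face hX um) ?cpart_sub //= disjoints_subset andbC.
rewrite pair_big_dep /=.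
rewrite (reindex_onto (fun U => (U :\: F, U :&: F)) (fun TS => TS.1 :|: TS.2)) /=.
  apply: eq_big => [U|U _]; last by rewrite -cpartU setUC setID.
  rewrite subsetIr {1}setDE subsetIr /= setUC setID eqxx andbT /layer.
  by rewrite -(cardsID F U) [RHS]andbC; case: eqP => // ->; rewrite eqn_add2r.
move=> [T S] /= /andP[/andP[TF _] /andP[SF _]].
have DTF : [disjoint T & F] by rewrite disjoints_subset.
rewrite setDUl (setDidPl DTF) setIUl (disjoint_setI0 DTF) set0U (setIidPl SF).
by move: SF; rewrite -setD_eq0 => /eqP->; rewrite setU0.
Qed.

Lemma color_avg_remove n j p :
  \sum_(U | layer F n j U)
    color_avg (fun u => \sum_(v in outside u) p (u :\ v)) U =
  \sum_(U | layer F n j U) \sum_(i in U :\: F) color_avg p (U :\ i).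
Proof.
apply: eq_bigr => U _; rewrite /color_avg [RHS]exchange_big /=.
apply: eq_bigr => u um; rewrite -mulr_sumr; congr (_ * _).
have eo : outside (cpart c U u) = cpart c (U :\: F) u.
  by apply/setP=> v; rewrite !inE -andbA [(c v \in U) && _]andbC.
have <- : c @: outside (cpart c U u) = U :\: F by rewrite eo; apply: (col_cpart hX).
rewrite big_imset /=.
  apply: eq_bigr => v vo; rewrite cpartD1 //.
  by move: vo; rewrite inE => /andP[].
rewrite eo; move=> v w /(subsetP (cpart_sub _ _ _)) vu /(subsetP (cpart_sub _ _ _)).
exact: (col_inj_max hX um).
Qed.

(** The local inequalities are added over [s], with the existential replaced by a sum over v (union
    bound). Deleting v from a face of layer i + 1 gives a face of layer i, and [sum_layer_remove]
    counts the repetitions. *)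
Lemma star_sum_layer n j (b : R) (bad Bad : pred {set V}) :
  (forall s, s \in level X j -> [disjoint col c s & F] ->
    b * 'C(#|F|, n.+1)%:R * star_sum n s (fun u => (bad u)%:R) <=
    'C(#|F|, n)%:R * star_sum n.+1 s
      (fun u => (Bad u || [exists v in s, bad (u :\ v)])%:R)) ->
  b * 'C(#|F|, n.+1)%:R * layer_sum F (n + j)%N j (color_avg (fun u => (bad u)%:R)) <=
  'C(#|F|, n)%:R * (layer_sum F (n.+1 + j)%N j (color_avg (fun u => (Bad u)%:R)) +
   if j is i.+1 then (d - #|F| - i)%:R *
     layer_sum F (n + j)%N i (color_avg (fun u => (bad u)%:R)) else 0).
Proof.
move=> hs; rewrite -sum_star_sum mulr_sumr.
apply: le_trans (_ : \sum_(s in level X j | [disjoint col c s & F]) 'C(#|F|, n)%:R *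
  star_sum n.+1 s (fun u => (Bad u)%:R + \sum_(v in outside u) (bad (u :\ v))%:R) <= _).
  apply: ler_sum => s /andP[sX sF]; apply: le_trans (hs s sX sF) _.
  apply: ler_wpM2l => //; apply: ler_sum => u /andP[um su].
  apply: ler_wpM2l; first exact: (weight_ge0 hX).
  apply: ler_sum => S /andP[SF _].
  (* Since [s] can be read off the face, the summand is a function of the face alone, as
     [sum_star_sum] requires. *)
  have -> : outside (s :|: cpart c S u) = s.
    by rewrite outsideU outside_id // outside0 ?setU0 // (col_cpart hX).
  case: (Bad _) => /=; first by rewrite lerDl sumr_ge0.
  rewrite add0r; case: existsP => [[v /andP[vs bv]]|_]; last by rewrite sumr_ge0.
  by rewrite (bigD1 v) //= bv lerDl sumr_ge0.
rewrite -mulr_sumr sum_star_sum; apply: ler_wpM2l => //.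
rewrite (_ : layer_sum _ _ _ _ = layer_sum F (n.+1 + j)%N j (color_avg (fun u => (Bad u)%:R)) +
  \sum_(U | layer F (n.+1 + j)%N j U) color_avg (fun u => \sum_(v in outside u) (bad (u :\ v))%:R) U).
  rewrite lerD2l (color_avg_remove _ _ (fun u => (bad u)%:R)).
  case: j {hs} => [|i]; last by rewrite addnS addSnnS sum_layer_remove.
  rewrite big1 // => U /andP[_]; rewrite cards_eq0 => /eqP->; exact: big_set0.
rewrite -big_split; apply: eq_bigr => U _; rewrite /color_avg -big_split.
by apply: eq_bigr => u _; rewrite mulrDr.
Qed.

Lemma Pr_color_avg n (P : pred {set V}) :
  Pr X n P = 'C(d, n)%:R^-1 *
    \sum_(S : {set 'I_d} | #|S| == n) color_avg (fun u => (P u)%:R) S.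
Proof. exact: (Pr_X hX). Qed.

Lemma color_avg_ge0 (P : pred {set V}) U : 0 <= color_avg (fun u => (P u)%:R) U.
Proof. by apply: sumr_ge0 => u um; rewrite mulr_ge0 ?(weight_ge0 hX). Qed.

End ColorSums.

(** * Abelian cochains as functions on sets *)

Section Signs.
Variable A : zmodType.

Definition sg (n : nat) (x : A) : A := if odd n then - x else x.

Lemma sgD m n x : sg (m + n) x = sg m (sg n x).
Proof. by rewrite /sg oddD; do 2 case: odd; rewrite ?opprK. Qed.

Lemma eq_sg m n x : odd m = odd n -> sg m x = sg n x.
Proof. by rewrite /sg => ->. Qed.

Lemma sgK n : involutive (sg n).
Proof. by rewrite /sg => x; case: odd; rewrite ?opprK. Qed.

Lemma sg_eq0 n x : (sg n x == 0) = (x == 0).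
Proof. by rewrite /sg; case: odd; rewrite ?oppr_eq0. Qed.

Lemma sg0 n : sg n 0 = 0.
Proof. by rewrite /sg oppr0 if_same. Qed.

Lemma sgB n x y : sg n (x - y) = sg n x - sg n y.
Proof. by rewrite /sg; case: odd; rewrite ?opprD. Qed.

Lemma sg_sum (I : Type) (r : seq I) (P : pred I) (f : I -> A) n :
  sg n (\sum_(i <- r | P i) f i) = \sum_(i <- r | P i) sg n (f i).
Proof. by rewrite /sg; case: odd; rewrite // sumrN. Qed.

End Signs.

Section SetCochains.
Variables (V : finType) (key : V -> nat).
Hypothesis key_inj : injective key.
Implicit Types (s t : {set V}).

Definition inc s v := #|[set u in s | (key u < key v)%N]|.

Lemma inc_lt_card s v : v \in s -> (inc s v < #|s|)%N.
Proof.
move=> vs; apply: proper_card; apply/properP; split.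
  by apply/subsetP=> u; rewrite inE => /andP[].
by exists v; rewrite // inE ltnn andbF.
Qed.

Lemma inc_mono s u v : u \in s -> (key u < key v)%N -> (inc s u < inc s v)%N.
Proof.
move=> us uv; apply: proper_card; apply/properP; split.
  apply/subsetP=> w; rewrite !inE => /andP[-> wu] /=; exact: ltn_trans uv.
by exists u; rewrite !inE us // ltnn andbF.
Qed.

Lemma inc_inj s : {in s &, injective (inc s)}.
Proof.
move=> u v us vs e; apply: key_inj; apply/eqP; case: ltngtP => // uv.
  by have := inc_mono us uv; rewrite e ltnn.
by have := inc_mono vs uv; rewrite e ltnn.
Qed.

Lemma incD1 s u v : u \in s -> inc s v = ((key u < key v) + inc (s :\ u) v)%N.
Proof.
move=> us; rewrite /inc [LHS](cardsD1 u) inE us /=; congr (_ + _)%N.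
by apply: eq_card => w; rewrite !inE andbA.
Qed.

(** [bump] is the shift of indices performed by [lift]: this matches deleting a vertex of a set with
    deleting an entry of a tuple. *)
Lemma bump_inc s u v : u \in s -> v \in s -> v != u ->
  bump (inc s u) (inc (s :\ u) v) = inc s v.
Proof.
move=> us vs vu; rewrite [RHS](incD1 _ us) /bump; congr (nat_of_bool _ + _)%N.
have : key v != key u by rewrite (inj_eq key_inj).
rewrite neq_ltn => /orP[lt|lt]; rewrite ?lt.
  have := inc_mono vs lt; rewrite (incD1 v us) [X in (X + _)%N](_ : _ = 0%N).
    by rewrite add0n ltnNge => /negPf->; apply/esym/negP => /(ltn_trans lt); rewrite ltnn.
  by case: ltnP => // /(ltn_trans lt); rewrite ltnn.
apply: subset_leq_card; apply/subsetP=> w; rewrite !inE => /andP[-> wu].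
rewrite (ltn_trans wu lt) !andbT; apply/eqP=> e; by rewrite e ltnn in wu.
Qed.

Section Coboundary.
Variable A : zmodType.
Implicit Types phi psi : {set V} -> A.

Definition scob phi t : A := \sum_(v in t) sg (inc t v) (phi (t :\ v)).

(** Deleting two vertices in either order gives the same set with opposite signs: deleting the
    vertex of smaller key first lowers the position of the other by one, the reverse order changes
    no position. *)
Lemma scob_scob phi t : scob (scob phi) t = 0.
Proof.
pose T v u := sg (inc t v + inc (t :\ v) u) (phi (t :\ v :\ u)).
have -> : scob (scob phi) t = \sum_(v in t) \sum_(u in t :\ v) T v u.
  by apply: eq_bigr => v _; rewrite sg_sum; apply: eq_bigr => u _; rewrite /T sgD.
have -> : \sum_(v in t) \sum_(u in t :\ v) T v u =
    \sum_(v in t) \sum_(u in t | (key u < key v)%N) T v u +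
    \sum_(v in t) \sum_(u in t | (key v < key u)%N) T v u.
  rewrite -big_split; apply: eq_bigr => v _.
  rewrite (bigID (fun u => (key u < key v)%N)) /=; congr (_ + _); apply: eq_bigl => u.
    rewrite !inE; have [->|//] := eqVneq u v; by rewrite ltnn !andbF.
  rewrite !inE -leqNgt -(inj_eq key_inj) eq_sym ltn_neqAle.
  by rewrite -andbA andbCA.
rewrite [X in X + _](exchange_big_dep (mem t)) /=; last by move=> v u _ /andP[].
rewrite -big_split big1 //= => u ut.
rewrite ut /= -big_split big1 //= => v /andP[vt uv].
rewrite /T (_ : t :\ v :\ u = t :\ u :\ v); last by apply/setP=> w; rewrite !inE andbCA.
rewrite (incD1 v ut) (incD1 u vt) uv (_ : (key v < key u)%N = false); last first.
  by apply/negP=> /(ltn_trans uv); rewrite ltnn.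
by rewrite add1n add0n addSn addnC /sg /=; case: odd; rewrite ?opprK ?addNr ?addrN.
Qed.

Lemma eq_scob phi psi t : (forall v, v \in t -> phi (t :\ v) = psi (t :\ v)) ->
  scob phi t = scob psi t.
Proof. by move=> e; apply: eq_bigr => v vt; rewrite e. Qed.

Lemma scobB phi psi t : scob (fun s => phi s - psi s) t = scob phi t - scob psi t.
Proof. by rewrite /scob -sumrB; apply: eq_bigr => v _; rewrite sgB. Qed.

Lemma scob_sg n phi t : scob (fun s => sg n (phi s)) t = sg n (scob phi t).
Proof.
by rewrite /scob sg_sum; apply: eq_bigr => v _; rewrite -!sgD addnC.
Qed.

End Coboundary.

(** * Signs of orderings of a face *)

Section TupleSign.

Definition tset n (t : n.-tuple V) : {set V} := [set v in t].

(** The permutation that sorts [t] by key, sending an index to the rank of its entry. The defaults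
    of [insubd] do not occur when [t] has no repetition. *)
Definition rank_perm n (t : n.-tuple V) : 'S_n :=
  insubd (1%g : 'S_n) [ffun i => insubd i (inc (tset t) (tnth t i))].

Lemma mem_tset n (t : n.-tuple V) i : tnth t i \in tset t.
Proof. by rewrite inE mem_tnth. Qed.

Lemma rank_permE n (t : n.-tuple V) i : uniq t ->
  rank_perm t i = inc (tset t) (tnth t i) :> nat.
Proof.
move=> ut; have lt j : (inc (tset t) (tnth t j) < n)%N.
  apply: leq_trans (inc_lt_card (mem_tset t j)) _.
  by rewrite cardsE (card_uniqP ut) size_tuple.
set f : {ffun 'I_n -> 'I_n} := [ffun i => insubd i (inc (tset t) (tnth t i))].
have inj_f : injectiveb f.
  apply/injectiveP=> i1 i2; rewrite !ffunE => /(congr1 val); rewrite !val_insubd !lt.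
  move=> /(inc_inj (mem_tset t i1) (mem_tset t i2)).
  exact: (tuple_uniqP _ ut).
by rewrite /rank_perm -/f unlock /= val_insubd inj_f ffunE val_insubd lt.
Qed.

Lemma delv_uniq n (t : n.+1.-tuple V) j : uniq t -> uniq (delv t j).
Proof.
move=> ut; apply/tuple_uniqP => i1 i2; rewrite !tnth_mktuple => e.
by apply: (@lift_inj _ j); apply/(tuple_uniqP _ ut).
Qed.

Lemma tset_delv n (t : n.+1.-tuple V) j : uniq t ->
  tset (delv t j) = tset t :\ tnth t j.
Proof.
move=> /tuple_uniqP ut; apply/setP=> v; rewrite !inE; apply/tnthP/andP.
  move=> [i ->]; rewrite tnth_mktuple mem_tnth; split=> //.
  by rewrite (inj_eq ut) eq_sym neq_lift.
move=> [vj /tnthP[i vi]]; move: vj; rewrite vi (inj_eq ut).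
case: (unliftP j i) => [i' ->|->]; last by rewrite eqxx.
by exists i'; rewrite tnth_mktuple.
Qed.

Lemma rank_perm_lift n (t : n.+1.-tuple V) j : uniq t ->
  rank_perm t = lift_perm j (rank_perm t j) (rank_perm (delv t j)).
Proof.
move=> ut; apply/permP=> i; case: (unliftP j i) => [i' ->|->]; last by rewrite lift_perm_id.
rewrite lift_perm_lift; apply: val_inj => /=.
rewrite !rank_permE ?delv_uniq // tset_delv // tnth_mktuple bump_inc ?mem_tset //.
by rewrite (inj_eq (tuple_uniqP _ ut)) eq_sym neq_lift.
Qed.

Definition tsign n (t : n.-tuple V) : bool := odd_perm (rank_perm t).

Lemma tsign_perm n (t : n.-tuple V) (pi : 'S_n) : uniq t ->
  tsign [tuple tnth t (pi i) | i < n] = pi (+) tsign t.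
Proof.
move=> ut; rewrite /tsign -odd_permM; congr odd_perm.
apply/permP=> i; rewrite permM; apply: val_inj; rewrite /= !rank_permE //.
  by rewrite tnth_mktuple /tset set_tuple_perm.
by apply/tuple_uniqP=> i1 i2; rewrite !tnth_mktuple => /(tuple_uniqP _ ut)/perm_inj.
Qed.

(** Deleting an entry of index j and rank i changes the sign of the sorting permutation by (-1)^(i +
    j). This converts the sign (-1)^j of the tuple formula into the sign by rank used in [scob]. *)
Lemma tsign_delv n (t : n.+1.-tuple V) (j : 'I_n.+1) : uniq t ->
  odd (j + tsign (delv t j))%N = odd (tsign t + inc (tset t) (tnth t j))%N.
Proof.
move=> ut; rewrite !oddD !oddb /tsign (rank_perm_lift j ut) odd_lift_perm rank_permE //.
by case: odd; case: odd; case: odd_perm.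
Qed.

End TupleSign.

Section Alternating.
Variable A : zmodType.

Definition alternating (Q : pred {set V}) n (f : n.-tuple V -> A) : Prop :=
  forall (t : n.-tuple V) (pi : 'S_n), uniq t -> Q (tset t) ->
    f [tuple tnth t (pi i) | i < n] = sg pi (f t).

Definition to_set n (f : n.-tuple V -> A) (s : {set V}) : A :=
  if [pick t : n.-tuple V | uniq t && (tset t == s)] is Some t
  then sg (tsign t) (f t) else 0.

Definition of_set n (phi : {set V} -> A) (t : n.-tuple V) : A :=
  sg (tsign t) (phi (tset t)).

Lemma of_set_alternating Q n (phi : {set V} -> A) : alternating Q (@of_set n phi).
Proof.
move=> t pi ut _; rewrite /of_set tsign_perm // {1}/tset set_tuple_perm -/(tset t).
by rewrite -sgD; apply: eq_sg; rewrite oddD !oddb.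
Qed.

Lemma to_setK (Q : pred {set V}) n (f : n.-tuple V -> A) (t : n.-tuple V) :
  alternating Q f -> uniq t -> Q (tset t) -> f t = sg (tsign t) (to_set f (tset t)).
Proof.
move=> af ut Qt; rewrite /to_set; case: pickP => [t' /andP[ut' /eqP e]|/(_ t)]; last by rewrite ut eqxx.
have /tuple_permP[pi et] : perm_eq t t'.
  apply: uniq_perm => // v; have : v \in tset t = (v \in tset t') by rewrite e.
  by rewrite !inE.
have {}et : t = [tuple tnth t' (pi i) | i < n] by apply: val_inj.
rewrite {1 2}et tsign_perm // af ?e // -sgD; apply: eq_sg.
by rewrite oddD !oddb -addbA addbb addbF.
Qed.

Definition acob n (f : n.-tuple V -> A) (t : n.+1.-tuple V) : A :=
  \sum_(j < n.+1) sg j (f (delv t j)).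

(** The set function is a parameter, rather than [to_set f], so that modified cochains can be given
    by formulas on sets. *)
Definition represents (Q : pred {set V}) n (f : n.-tuple V -> A) phi : Prop :=
  forall t : n.-tuple V, uniq t -> Q (tset t) -> f t = of_set phi t.

Lemma represents_to_set Q n (f : n.-tuple V -> A) : alternating Q f ->
  represents Q f (to_set f).
Proof. by move=> af t ut Qt; apply: to_setK af ut Qt. Qed.

Lemma acob_scob (Q : pred {set V}) n (f : n.-tuple V -> A) phi (t : n.+1.-tuple V) :
  (forall s s' : {set V}, s \subset s' -> Q s' -> Q s) ->
  represents Q f phi -> uniq t -> Q (tset t) ->
  acob f t = sg (tsign t) (scob phi (tset t)).
Proof.
move=> Qdown rf ut Qt; rewrite /scob sg_sum.
transitivity (\sum_(v <- t) sg (tsign t) (sg (inc (tset t) v) (phi (tset t :\ v)))).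
  rewrite big_tuple; apply: eq_bigr => j _.
  have Qj : Q (tset (delv t j)).
    by rewrite tset_delv //; apply: Qdown Qt; apply: subD1set.
  rewrite rf ?delv_uniq // /of_set tset_delv //.
  by rewrite -!sgD; apply: eq_sg; apply: tsign_delv.
by rewrite big_uniq //; apply: eq_bigl => v; rewrite inE.
Qed.

End Alternating.

End SetCochains.

(** Commutativity is only a hypothesis on the multiplicative group G. The alias carries it as an
    additive group and is convertible to G, so cochains can be used on both sides without
    transport. *)
Definition abelian_copy (G : groupType) (cG : forall x y : G, (x * y = y * x)%g) : Type := G.
HB.instance Definition _ G cG := Choice.copy (@abelian_copy G cG) G.
HB.instance Definition _ (G : groupType) cG :=
  GRing.isZmodule.Build (@abelian_copy G cG) (@mulgA G) cG (@mul1g G) (@mulVg G).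

Section LowDegree.
Variables (R : realType) (V : finType) (G : groupType) (Y : wcomplex R V).

Lemma tuple1E (T : Type) (t : 1.-tuple T) : t = [tuple tnth t ord0].
Proof. by apply: eq_from_tnth => i; rewrite [i]ord1 tnth0. Qed.

Lemma tuple2E (T : Type) (t : 2.-tuple T) : t = [tuple tnth t ord0; tnth t ord_max].
Proof.
apply: eq_from_tnth => i; case: (unliftP ord0 i) => [j ->|->]; last by rewrite tnth0.
by rewrite tnthS [j]ord1 tnth0; congr tnth; apply: val_inj.
Qed.

Lemma cochain_swap (f : 2.-tuple V -> G) u v : cochains Y f ->
  oface Y [tuple u; v] -> f [tuple u; v] = (f [tuple v; u])^-1%g.
Proof.
move=> cf uvY; have := cf _ (tperm ord0 ord_max) uvY.
rewrite odd_tperm /= => e; rewrite -[LHS]invgK -e; congr (f _)^-1%g.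
by rewrite [LHS]tuple2E !tnth_mktuple tpermL tpermR tnth0 (_ : ord_max = lift ord0 ord0) ?tnthS ?tnth0 //; apply: val_inj.
Qed.

End LowDegree.

Section AbelianCochains.
Variables (R : realType) (V : finType) (G : groupType).
Hypothesis cG : forall x y : G, (x * y = y * x)%g.
Variables (key : V -> nat) (Y : wcomplex R V).
Hypothesis key_inj : injective key.
Hypothesis Y_closed : forall s t : {set V}, s \in faces Y -> t \subset s -> t \in faces Y.
Let A : zmodType := @abelian_copy G cG.
Implicit Types (s : {set V}).

Lemma oface_sub m n (r : m.-tuple V) (t : n.-tuple V) :
  uniq r -> {subset r <= t} -> oface Y t -> oface Y r.
Proof.
move=> ur rt /andP[_ tY]; rewrite /oface ur; apply: Y_closed tY _.
by apply/subsetP=> v; rewrite !inE; apply: rt.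
Qed.

Lemma cochains_alternating n (f : n.-tuple V -> G) :
  cochains Y f <-> alternating (mem (faces Y)) (f : n.-tuple V -> A).
Proof.
split=> cf t pi.
  move=> ut tY; have := cf t pi; rewrite /oface ut => -> //.
  by rewrite /sg oddb.
by case/andP=> ut tY; rewrite cf // /sg oddb.
Qed.

(** For n = 1, h(v) h(u)^-1 is the inverse of the alternating sum, whence the sign. For n = 2 the
    factor h(wv) is turned into h(vw)^-1 by antisymmetry; this is where [f] has to be a cochain. *)
Lemma cobd_acob n (f : n.-tuple V -> G) (t : n.+1.-tuple V) : cochains Y f -> oface Y t ->
  cobd f t = sg (n == 1%N) (acob (f : n.-tuple V -> A) t).
Proof.
case: n f t => [|[|[|n]]] f t cf tY.
- by rewrite /acob big_ord1 /sg /= [delv _ _]tuple0.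
- rewrite /acob !big_ord_recl big_ord0 /sg /= addr0 opprB /=.
  congr (f _ * (f _)^-1)%g; apply: eq_from_tnth => i; rewrite tnth_mktuple.
  + by rewrite [i]ord1 tnth0; congr tnth; apply: val_inj; rewrite /= inordK.
  + by rewrite [i]ord1 tnth0; congr tnth; apply: val_inj; rewrite /= inordK.
- rewrite /acob !big_ord_recl big_ord0 /sg /= addr0.
  have delv2 (j x y : 'I_3) : lift j (ord0 : 'I_2) = x -> lift j (ord_max : 'I_2) = y ->
      delv t j = [tuple tnth t x; tnth t y].
    move=> <- <-; apply: eq_from_tnth => i; rewrite tnth_mktuple.
    case: (unliftP ord0 i) => [i' ->|->]; last by rewrite tnth0.
    by rewrite tnthS [i']ord1 tnth0; congr (tnth t (lift j _)); apply: val_inj.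
  rewrite (delv2 ord0 (inord 1) (inord 2)); try by apply: val_inj; rewrite /= inordK.
  rewrite (delv2 _ (inord 0) (inord 2)); try by apply: val_inj; rewrite /= inordK.
  rewrite (delv2 _ (inord 0) (inord 1)); try by apply: val_inj; rewrite /= inordK.
  rewrite (cochain_swap (Y := Y) (f := f) (u := tnth t (inord 2)) (v := tnth t (inord 0))) //.
    by rewrite addrA addrC addrA.
  apply: (oface_sub _ _ tY) => [|x]; last by rewrite !inE => /orP[]/eqP->; apply: mem_tnth.
  case/andP: tY => /tuple_uniqP ut _; rewrite /= andbT inE (inj_eq ut).
  by rewrite -(inj_eq val_inj) /= !inordK.
- by [].
Qed.

Lemma cobd_scob n (f : n.-tuple V -> G) (phi : {set V} -> A) (t : n.+1.-tuple V) :
  cochains Y f -> represents key (mem (faces Y)) (f : n.-tuple V -> A) phi -> oface Y t ->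
  cobd f t = sg (tsign key t) (sg (n == 1%N) (scob key phi (tset t))).
Proof.
move=> cf rf tY; have /andP[ut st] := tY.
rewrite cobd_acob // (acob_scob key_inj _ rf) //.
  by rewrite -!sgD addnC.
by move=> s s' ss' /= s'Y; apply: Y_closed s'Y ss'.
Qed.

(** Reordering [s] changes both functions by the same sign, so disagreement on some ordering is
    disagreement of the two values attached to the set. *)
Lemma disagree_sg n (f g : n.-tuple V -> G) (e : n.-tuple V -> nat) (x y : A) s :
  #|s| = n ->
  (forall t : n.-tuple V, tset t = s -> f t = sg (e t) x) ->
  (forall t : n.-tuple V, tset t = s -> g t = sg (e t) y) ->
  disagree f g s = (x != y).
Proof.
move=> sn fx gy; apply/idP/idP => [/existsP[t /andP[/eqP st]]|xy].
  by rewrite fx // gy //; apply: contraNneq => ->.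
have sz : size (enum s) == n by rewrite -cardE sn.
apply/existsP; exists (Tuple sz).
have st : tset (Tuple sz) = s by apply/setP=> v; rewrite inE mem_enum.
rewrite -/(tset _) st eqxx fx // gy //=.
apply: contraNneq xy => exy; apply/eqP.
by rewrite -[LHS](sgK (e (Tuple sz))) exy sgK.
Qed.

End AbelianCochains.

(** * Correcting a cochain on the link of a face *)

Section LocalSteps.
Variables (R : realType) (V : finType) (G : groupType) (d : nat).
Variables (X : wcomplex R V) (c : V -> 'I_d).
Hypothesis hX : partite_complex X c.
Variable F : {set 'I_d}.
Implicit Types (s r u : {set V}).

Local Notation Bad f := (disagree (cobd f) (fun _ => 1%g)).
Local Notation bad f g := (disagree f (cobd g)).

(* With the colors of F first, adding vertices outside F to a face does not
   change the signs of its vertices inside F, see [inc_inside]. *)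
Definition color_key v : nat := (enum_rank v + (c v \notin F) * #|V|)%N.

Lemma color_key_lt (u v : V) : c u \in F -> c v \notin F -> (color_key u < color_key v)%N.
Proof.
move=> uF vF; rewrite /color_key uF vF mul1n addn0.
by apply: leq_trans (ltn_ord _) _; rewrite leq_addl.
Qed.

Lemma color_key_inj : injective color_key.
Proof.
move=> u v e; have [uF|uF] := boolP (c u \in F); have [vF|vF] := boolP (c v \in F).
- by move: e; rewrite /color_key uF vF !addn0 => /val_inj/enum_rank_inj.
- by have := color_key_lt uF vF; rewrite e ltnn.
- by have := color_key_lt vF uF; rewrite e ltnn.
- by move: e; rewrite /color_key uF vF => /addIn/val_inj/enum_rank_inj.
Qed.

Lemma disjoint_col s v : [disjoint col c s & F] -> v \in s -> c v \notin F.
Proof. by move=> sF vs; rewrite (disjointFr sF) //; apply: imset_f. Qed.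

Lemma sub_col r v : col c r \subset F -> v \in r -> c v \in F.
Proof. by move=> /subsetP rF vr; apply: rF; apply: imset_f. Qed.

Lemma disjoint_by_color s r : [disjoint col c s & F] -> col c r \subset F -> [disjoint s & r].
Proof.
move=> sF rF; apply/pred0P=> v /=; apply/negP=> /andP[vs vr].
by have := disjoint_col sF vs; rewrite (sub_col rF).
Qed.

Lemma inc_inside s r v : [disjoint col c s & F] -> col c r \subset F -> v \in r ->
  inc color_key (s :|: r) v = inc color_key r v.
Proof.
move=> sF rF vr; apply: eq_card => u; rewrite !inE.
case us: (u \in s) => //=; rewrite ltnNge ltnW ?andbF //.
by apply: color_key_lt; rewrite ?(disjoint_col sF us) // (sub_col rF vr).
Qed.

Definition mix k s (h g : k.-tuple V -> G) (t : k.-tuple V) : G :=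
  if outside c F (tset t) == s then h t else g t.

Lemma mix_cochain k s (h g : k.-tuple V -> G) :
  cochains X h -> cochains X g -> cochains X (mix s h g).
Proof.
move=> ch cg t pi tX; rewrite /mix {1}/tset set_tuple_perm -/(tset t).
by case: ifP => _; [apply: ch | apply: cg].
Qed.

(** All repetition-free tuples with entries in [t] are allowed, not only the [delv t j], because the
    formula for n = 2 evaluates g at (w, v). *)
Lemma cobd_local n (g h : n.-tuple V -> G) (t : n.+1.-tuple V) : uniq t ->
  (forall r : n.-tuple V, uniq r -> {subset r <= t} -> g r = h r) ->
  cobd g t = cobd h t.
Proof.
case: n g h t => [|[|[|n]]] g h t ut gh /=.
- by apply: gh.
- by rewrite !gh // => v; rewrite inE => /eqP->; apply: mem_tnth.
- have neq i j : (i < 3)%N -> (j < 3)%N -> i != j -> tnth t (inord i) != tnth t (inord j).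
    move=> i3 j3 ij; rewrite (inj_eq (tuple_uniqP _ ut)).
    by rewrite -(inj_eq val_inj) /= !inordK.
  by rewrite !gh //= ?inE ?neq // => v; rewrite !inE => /orP[]/eqP->; apply: mem_tnth.
- have e j : g (delv t j) = h (delv t j).
    apply: gh => [|v /tnthP[i ->]]; first exact: delv_uniq.
    by rewrite tnth_mktuple mem_tnth.
  by apply: eq_bigr => j _; rewrite e.
Qed.

(** The cochain [phi] is the part of [f] left over on the link [Y] of [s]. The second clause bounds
    its failure to be a cocycle; the third turns an approximation of [phi] by a coboundary into
    values of [g] on the faces with outside part [s]. In use, k = n + |s|. *)
Definition correctable k n (Y : wcomplex R V) s (f : k.+1.-tuple V -> G)
    (g : k.-tuple V -> G) : Prop :=
  exists phi : n.+1.-tuple V -> G, [/\ cochains Y phi,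
    {in level Y n.+2, forall r, Bad phi r ->
      Bad f (s :|: r) || [exists v in s, bad f g ((s :|: r) :\ v)]} &
    forall h : n.-tuple V -> G, cochains Y h ->
      exists2 h' : k.-tuple V -> G, cochains X h' &
      {in level Y n.+1, forall r,
        bad f (mix s h' g) (s :|: r) -> bad phi h r}].

Lemma correctable0 k (Y : wcomplex R V) (f : k.+1.-tuple V -> G) (g : k.-tuple V -> G) :
  faces Y = link_faces X c F set0 -> cochains X f -> correctable k Y set0 f g.
Proof.
move=> fY cf; have YX : forall t : {set V}, t \in faces Y -> t \in faces X.
  by move=> t; rewrite fY inE => /and3P[].
have out0 r : r \in faces Y -> outside c F r = set0.
  by rewrite fY inE => /and3P[_ rF _]; apply: outside0.
have Yc r r' : r \in faces Y -> r' \subset r -> r' \in faces Y.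
  rewrite fY !inE !setU0 => /and3P[rX rF _] r'r; have r'X := faces_closed hX rX r'r.
  by rewrite r'X (subset_trans _ rF) // imsetS.
exists f; split.
- by move=> t pi /andP[ut tY]; apply: cf; rewrite /oface ut YX.
- by move=> r _; rewrite set0U => ->.
(* The values of [h] off the faces of [Y] are arbitrary, so they are replaced by 1 to obtain a
   cochain on X. *)
- move=> h ch; exists (fun t => if tset t \in faces Y then h t else 1%g).
    move=> t pi /andP[ut tX]; rewrite {1}/tset set_tuple_perm -/(tset t).
    case: ifP => [tY|_]; last by rewrite invg1 if_same.
    by apply: ch; rewrite /oface ut.
  move=> r; rewrite inE set0U => /andP[rY /eqP rk].
  rewrite (@eq_disagree _ _ _ _ _ (cobd h)) // => t tr.
  apply: cobd_local => [|t' ut' tt']; first by rewrite uniq_card_tuple tr rk.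
  have t'Y : tset t' \in faces Y.
    by apply: Yc rY _; rewrite -tr; apply/subsetP=> v; rewrite !inE; apply: tt'.
  by rewrite /mix out0 // eqxx t'Y.
Qed.

Lemma link_faces_closed s (Y : wcomplex R V) : faces Y = link_faces X c F s ->
  forall r r' : {set V}, r \in faces Y -> r' \subset r -> r' \in faces Y.
Proof.
move=> fY r r'; rewrite fY !inE => /and3P[rX rF rsX] r'r.
rewrite (faces_closed hX rX r'r) (subset_trans _ rF) ?imsetS //=.
by apply: (faces_closed hX rsX); apply: setSU.
Qed.

(** * The leftover cochain for abelian coefficients *)

Section Abelian.
Hypothesis cG : forall x y : G, (x * y = y * x)%g.
Let A : zmodType := @abelian_copy G cG.
Local Notation key := color_key.
Local Notation Xc := (faces_closed hX).

Lemma cochain_represents (Y : wcomplex R V) n (f : n.-tuple V -> G) : cochains Y f ->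
  represents key (mem (faces Y)) (f : n.-tuple V -> A) (to_set key (f : n.-tuple V -> A)).
Proof.
by move=> /(cochains_alternating cG); apply: represents_to_set; apply: color_key_inj.
Qed.

Lemma Bad_scob (Y : wcomplex R V) n (f : n.-tuple V -> G) (phi : {set V} -> A) :
  (forall s t : {set V}, s \in faces Y -> t \subset s -> t \in faces Y) ->
  cochains Y f -> represents key (mem (faces Y)) (f : n.-tuple V -> A) phi ->
  {in level Y n.+1, forall s, Bad f s = (scob key phi s != 0)}.
Proof.
move=> Yc cf rf s sY; have := sY; rewrite inE => /andP[_ /eqP sn].
rewrite (@disagree_sg _ _ cG _ _ _ (fun t => tsign key t + (n == 1%N))%N (scob key phi s) 0) //.
  move=> t st; rewrite (cobd_scob color_key_inj Yc cf rf) ?st ?sgD //.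
  by rewrite oface_level -/(tset t) st.
by move=> t _; rewrite sg0.
Qed.

Lemma bad_scob (Y : wcomplex R V) n (f : n.+1.-tuple V -> G) (g : n.-tuple V -> G)
    (phi psi : {set V} -> A) :
  (forall s t : {set V}, s \in faces Y -> t \subset s -> t \in faces Y) ->
  cochains Y g -> represents key (mem (faces Y)) (f : n.+1.-tuple V -> A) phi ->
  represents key (mem (faces Y)) (g : n.-tuple V -> A) psi ->
  {in level Y n.+1, forall s, bad f g s = (phi s != sg (n == 1%N) (scob key psi s))}.
Proof.
move=> Yc cg rf rg s sY; have := sY; rewrite inE => /andP[sF /eqP sn].
rewrite (@disagree_sg _ _ cG _ _ _ (fun t => tsign key t) (phi s) (sg (n == 1%N) (scob key psi s))) //.
  move=> t st; rewrite rf /of_set ?st //.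
  by rewrite uniq_card_tuple -/(tset t) st sn.
move=> t st; rewrite (cobd_scob color_key_inj Yc cg rg) ?st //.
by rewrite oface_level -/(tset t) st.
Qed.

(** With g0 equal to [g] except for the value 0 on faces of outside part [s], the leftover is f1 = f
    - δ g0, evaluated at s ∪ r. As δ f1 = δ f, the coboundary of the leftover at r is δ f(s ∪ r) up
    to terms that delete a vertex of [s]. *)
Lemma correctable_abelian k n (Y : wcomplex R V) s (f : k.+1.-tuple V -> G)
    (g : k.-tuple V -> G) :
  (1 < k)%N -> k = (n + #|s|)%N -> [disjoint col c s & F] ->
  faces Y = link_faces X c F s -> cochains X f -> cochains X g ->
  correctable n Y s f g.
Proof.
move=> k1 kn sF fY cf cg.
have k1F : (k == 1%N) = false by apply/eqP; lia.
have Yc := link_faces_closed fY.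
have rf := cochain_represents cf; have rg := cochain_represents cg.
set fh := to_set _ _ in rf; set gh := to_set _ _ in rg.
pose g0 t := if outside c F t == s then 0 else gh t.
pose f1 t := fh t - scob key g0 t.
pose phis r := f1 (s :|: r).
have YF r : r \in faces Y -> col c r \subset F by rewrite fY inE => /and3P[].
have YX r : r \in faces Y -> s :|: r \in faces X by rewrite fY inE setUC => /and3P[].
have Ydis r : r \in faces Y -> [disjoint s & r].
  by move=> /YF; apply: disjoint_by_color sF.
have Ycard r : r \in faces Y -> #|s :|: r| = (#|s| + #|r|)%N.
  by move=> /Ydis dis; rewrite cardsU (disjoint_setI0 dis) cards0 subn0.
have outD r v : r \in faces Y -> v \in s -> outside c F ((s :|: r) :\ v) != s.
  move=> rY vs; apply/eqP => e; have : v \in s by [].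
  by rewrite -e !inE eqxx.
have outR r v : r \in faces Y -> v \in r -> outside c F (s :|: (r :\ v)) = s.
  move=> rY vr; rewrite outsideU outside_id // outside0 ?setU0 //.
  by apply: subset_trans (YF _ rY); apply: imsetS; apply: subD1set.
(* Colors of F come first in the order, so the terms deleting a vertex of [r] have the signs of the
   coboundary in the link. *)
have split r (p : {set V} -> A) : r \in faces Y -> scob key p (s :|: r) =
    \sum_(v in s) sg (inc key (s :|: r) v) (p ((s :|: r) :\ v)) +
    \sum_(v in r) sg (inc key r v) (p (s :|: (r :\ v))).
  move=> rY; rewrite /scob (eq_bigl [predU s & r]); last by move=> v; rewrite !inE.
  rewrite bigU ?Ydis //=; congr (_ + _); apply: eq_bigr => v vr.
  rewrite inc_inside ?YF //; congr (sg _ (p _)).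
  rewrite setDUl (setDidPl _) // disjoint_sym disjoints1.
  by rewrite (disjointFl (Ydis _ rY)).
have cY : cochains Y (of_set key phis : n.+1.-tuple V -> G).
  by apply/(cochains_alternating cG); apply: (of_set_alternating color_key_inj).
have rY : represents key (mem (faces Y)) (of_set key phis : n.+1.-tuple V -> A) phis by [].
exists (of_set key phis : n.+1.-tuple V -> G); split => //.
  move=> r rn; have := rn; rewrite inE => /andP[rfY /eqP rc].
  rewrite (Bad_scob Yc cY rY) //; apply: contraR; rewrite negb_or => /andP[nBad nbad].
  have srX : s :|: r \in level X k.+2 by rewrite inE YX // Ycard // rc kn; apply/eqP; lia.
  move: nBad; rewrite (Bad_scob Xc cf rf) // negbK => /eqP df.
  have e : scob key f1 (s :|: r) = 0.
    by rewrite scobB scob_scob ?subr0 //; apply: color_key_inj.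
  move: e; rewrite split // big1 ?add0r => [e|v vs]; first by apply/eqP.
  move: nbad; rewrite negb_exists => /forallP/(_ v); rewrite vs /=.
  rewrite (bad_scob Xc cg rf rg); last first.
    rewrite inE (Xc (YX _ rfY)) ?subD1set //=.
    by move: srX; rewrite inE (cardsD1 v) inE vs /= => /andP[_].
  rewrite negbK k1F [sg false _]/(sg 0 _) /sg /= => /eqP fe.
  (* No subface of (s ∪ r) \ v has outside part [s], so g0 and [g] agree there, and f1 vanishes
     because [f] agrees with the coboundary of [g]. *)
  rewrite /f1 fe (@eq_scob _ _ _ _ gh) ?subrr ?oppr0 ?if_same // => w.
  rewrite !inE => /andP[wv ws]; rewrite /g0 ifN //.
  apply/eqP => e; have : v \in s by [].
  by rewrite -e !inE eqxx !andbF.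
move=> h ch; have rh := cochain_represents ch; set hh := to_set _ _ in rh.
(* The sign compensates the inverted coboundary for n = 1 in the link; there is none on X since k >
   1. *)
pose h0 t := sg (n == 1%N) (hh (t :\: s)).
pose g' t := if outside c F t == s then h0 t else gh t.
have ch' : cochains X (of_set key h0 : k.-tuple V -> G).
  by apply/(cochains_alternating cG); apply: (of_set_alternating color_key_inj).
exists (of_set key h0 : k.-tuple V -> G) => // r rn.
have := rn; rewrite inE => /andP[rfY /eqP rc].
have rm : represents key (mem (faces X)) (mix s (of_set key h0 : k.-tuple V -> G) g : k.-tuple V -> A) g'.
  by move=> t ut tX; rewrite /mix {2}/of_set /g'; case: ifP => // _; rewrite rg.
rewrite (bad_scob Xc (mix_cochain s ch' cg) rf rm); last first.
  by rewrite inE YX // Ycard // rc kn; apply/eqP; lia.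
rewrite (bad_scob Yc ch rY rh) // k1F; apply: contraNneq => e; apply/eqP.
rewrite -[fh _](subrK (scob key g0 (s :|: r))) -[_ - _]/(phis r) e.
rewrite -[sg false _]/(scob key g' (s :|: r)) !split // [X in _ + (_ + X)]big1 ?addr0 => [|v vr]; last first.
  by rewrite /g0 outR // eqxx sg0.
rewrite addrC; congr (_ + _).
  by apply: eq_bigr => v vs; rewrite /g0 /g' (negPf (outD _ _ rfY vs)).
rewrite -scob_sg; apply: eq_bigr => v vr; rewrite /g' outR // eqxx /h0.
congr (sg _ (sg _ (hh _))); rewrite setDUl setDv set0U.
apply/esym/setDidPl; rewrite disjoint_sym; apply: disjointWr (Ydis _ rfY).
exact: subD1set.
Qed.

(** The difference f - δ g has the same coboundary as [f]. If that is zero on [u] and all facets but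
    one contribute zero, the remaining facet does too. *)
Lemma closing_abelian k (f : k.+1.-tuple V -> G) (g : k.-tuple V -> G) u x :
  (1 < k)%N -> cochains X f -> cochains X g -> u \in level X k.+2 -> x \in u ->
  bad f g (u :\ x) -> Bad f u || [exists v in u :\ x, bad f g (u :\ v)].
Proof.
move=> k1 cf cg uX xu; have k1F : (k == 1%N) = false by apply/eqP; lia.
have rf := cochain_represents cf; have rg := cochain_represents cg.
set fh := to_set _ _ in rf; set gh := to_set _ _ in rg.
have := uX; rewrite inE => /andP[ufX /eqP uc].
have lv v : v \in u -> u :\ v \in level X k.+1.
  move=> vu; rewrite inE (Xc ufX) ?subD1set //=.
  by move: uc; rewrite (cardsD1 v) vu add1n => -[->].
pose f1 t := fh t - scob key gh t.
have badE v : v \in u -> bad f g (u :\ v) = (f1 (u :\ v) != 0).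
  by move=> vu; rewrite (bad_scob Xc cg rf rg) ?lv // k1F /sg /= subr_eq0.
rewrite badE //; apply: contraR; rewrite negb_or => /andP[].
rewrite (Bad_scob Xc cf rf) // negbK => /eqP df; rewrite negb_exists => /forallP nb.
have : scob key f1 u = 0 by rewrite scobB scob_scob ?subr0 //; apply: color_key_inj.
rewrite /scob (bigD1 x) //= big1 ?addr0 => [/eqP|v /andP[vu vx]]; first by rewrite sg_eq0.
have := nb v; rewrite in_setD1 vx vu /= badE // negbK => /eqP->; exact: sg0.
Qed.

Lemma cobd_cochain_abelian k (g : k.-tuple V -> G) :
  (1 < k)%N -> cochains X g -> cochains X (cobd g).
Proof.
move=> k1 cg; have k1F : (k == 1%N) = false by apply/eqP; lia.
have rg := cochain_represents cg.
apply/(cochains_alternating cG) => t pi ut tX.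
have tX' : oface X t by rewrite /oface ut.
rewrite !(cobd_scob color_key_inj Xc cg rg) //.
  by rewrite tsign_perm ?[tset [tuple _ | _ < _]]set_tuple_perm -?sgD ?k1F; [apply: eq_sg; rewrite !oddD !oddb|apply: color_key_inj|].
by rewrite oface_level set_tuple_perm -oface_level.
Qed.

Lemma cobd_cobd_abelian k (g : k.-tuple V -> G) (f : k.+1.-tuple V -> G) :
  (1 < k)%N -> cochains X g -> (forall t, oface X t -> f t = cobd g t) ->
  forall t, oface X t -> cobd f t = 1%g.
Proof.
move=> k1 cg fg t tX; have k1F : (k == 1%N) = false by apply/eqP; lia.
have rg := cochain_represents cg; set gh := to_set _ _ in rg.
have rf : represents key (mem (faces X)) (f : k.+1.-tuple V -> A) (scob key gh).
  move=> r ur rX; have rX' : oface X r by rewrite /oface ur.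
  by rewrite fg // (cobd_scob color_key_inj Xc cg rg) // k1F.
have cf : cochains X f.
  apply/(cochains_alternating cG) => r pi ur rX.
  have rX' : oface X r by rewrite /oface ur.
  rewrite !fg //; first exact: (cochains_alternating cG _ _).1 (cobd_cochain_abelian k1 cg) _ _ _ _.
  by rewrite oface_level set_tuple_perm -oface_level.
by rewrite (cobd_scob color_key_inj Xc cf rf) // scob_scob ?sg0 //; apply: color_key_inj.
Qed.

End Abelian.
End LocalSteps.

(** * Non-abelian cochains in low degree *)

Section NonAbelian.
Variables (R : realType) (V : finType) (G : groupType).
Local Open Scope group_scope.
Local Notation Bad f := (disagree (cobd f) (fun _ => 1%g)).
Local Notation bad f g := (disagree f (cobd g)).

Lemma cobd1E (g : 1.-tuple V -> G) a b :
  cobd g [tuple a; b] = g [tuple a] * (g [tuple b])^-1.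
Proof. by rewrite /= !(tnth_nth a) !inordK. Qed.

Lemma cobd2E (g : 2.-tuple V -> G) a b e :
  cobd g [tuple a; b; e] = g [tuple a; b] * g [tuple b; e] * g [tuple e; a].
Proof. by rewrite /= !(tnth_nth a) !inordK. Qed.

Lemma tuple1P (t : 1.-tuple V) : {a | t = [tuple a]}.
Proof. by exists (tnth t ord0); apply: tuple1E. Qed.

Lemma tuple2P (t : 2.-tuple V) : {a & {b | t = [tuple a; b]}}.
Proof. by exists (tnth t ord0), (tnth t ord_max); apply: tuple2E. Qed.

Lemma tuple3P (t : 3.-tuple V) : {a & {b & {e | t = [tuple a; b; e]}}}.
Proof.
case: t => -[|a [|b [|e []]]] // t3; exists a, b, e; exact: val_inj.
Qed.

Lemma tset1 (a : V) : tset [tuple a] = [set a].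
Proof. by apply/setP=> v; rewrite !inE. Qed.

Lemma tset2 (a b : V) : tset [tuple a; b] = [set a; b].
Proof. by apply/setP=> v; rewrite !inE. Qed.

Lemma tset3 (a b e : V) : tset [tuple a; b; e] = [set a; b; e].
Proof. by apply/setP=> v; rewrite !inE orbA. Qed.

Lemma cochains1 (Y : wcomplex R V) (f : 1.-tuple V -> G) : cochains Y f.
Proof.
move=> t pi _; have -> : pi = 1%g by apply/permP=> i; rewrite perm1 [i]ord1 ord1.
rewrite odd_perm1; congr f; apply: eq_from_tnth => i.
by rewrite tnth_mktuple perm1.
Qed.

Lemma closing0 (f : 1.-tuple V -> G) (g : 0.-tuple V -> G) (u : {set V}) x : x \in u ->
  bad f g (u :\ x) -> Bad f u || [exists v in u :\ x, bad f g (u :\ v)].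
Proof.
move=> xu; apply: contraLR; rewrite negb_or => /andP[/disagreeN nB].
rewrite negb_exists => /forallP nb; apply/disagreeN => t.
have [a ->] := tuple1P t => ta.
have eu : u = [set a; x] by rewrite -(setD1K xu) -ta -/(tset _) tset1 setUC.
have ax : a != x.
  have : a \in u :\ x by rewrite -ta !inE.
  by rewrite !inE => /andP[].
have := nB [tuple a; x]; rewrite -/(tset _) tset2 cobd1E -eu => /(_ erefl) e1.
have := nb a; rewrite -ta inE mem_seq1 eqxx /= => /disagreeN/(_ [tuple x]).
have -> : u :\ a = [set x].
  apply/setP=> v; rewrite eu !inE; have [->|//] := eqVneq v a.
  by rewrite (negPf ax).
rewrite -/(tset _) tset1 => /(_ erefl) e2.
by move: e1; rewrite e2 => /(canRL (mulgVK _)); rewrite mul1g.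
Qed.

(** On a triangle {a, b, x}, f(ab) f(bx) f(xa) = 1 with f(bx) = g(b) g(x)^-1 and f(xa) = g(x)
    g(a)^-1 forces f(ab) = g(a) g(b)^-1, in this order of factors. *)
Lemma closing1 (X : wcomplex R V) (f : 2.-tuple V -> G) (g : 1.-tuple V -> G)
    (u : {set V}) x :
  u \in level X 3 -> x \in u ->
  bad f g (u :\ x) -> Bad f u || [exists v in u :\ x, bad f g (u :\ v)].
Proof.
move=> uX xu; apply: contraLR; rewrite negb_or => /andP[/disagreeN nB].
rewrite negb_exists => /forallP nb; apply/disagreeN => t.
have [a [b ->]] := tuple2P t => tab.
have {}tab : u :\ x = [set a; b] by rewrite -tab -/(tset _) tset2.
have eu : u = [set a; b; x] by rewrite -(setD1K xu) tab setUC.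
have u3 : uniq [:: a; b; x].
  move: uX; rewrite inE eu -tset3 => /andP[_]; rewrite -uniq_card_tuple; done.
have {u3} /and3P[] := u3; rewrite !inE negb_or => /andP[ab ax] bx _.
have ba : b != a by rewrite eq_sym.
have := nB [tuple a; b; x]; rewrite -/(tset _) tset3 cobd2E -eu => /(_ erefl) e1.
have eb : u :\ b = [set x; a].
  apply/setP=> v; rewrite eu !inE; have [->|] := eqVneq v b.
    by rewrite (negPf ba) (negPf bx).
  by case: (v == a); case: (v == x).
have ea : u :\ a = [set b; x].
  apply/setP=> v; rewrite eu !inE; have [->|] := eqVneq v a.
    by rewrite (negPf ab) (negPf ax).
  by [].
have nb' v : v \in u :\ x -> ~~ bad f g (u :\ v) by move=> vu; have := nb v; rewrite vu.
have /disagreeN/(_ [tuple b; x]) : ~~ bad f g (u :\ a) by rewrite nb' // tab !inE eqxx.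
rewrite ea -/(tset _) tset2 cobd1E => /(_ erefl) e2.
have /disagreeN/(_ [tuple x; a]) : ~~ bad f g (u :\ b) by rewrite nb' // tab !inE eqxx orbT.
rewrite eb -/(tset _) tset2 cobd1E => /(_ erefl) e3.
rewrite e2 e3 in e1.
have : f [tuple a; b] * (g [tuple b] * (g [tuple a])^-1) = 1.
  by rewrite -e1 !mulgA mulgVK.
by move/(canRL (mulgK _)); rewrite mul1g invMg invgK cobd1E.
Qed.

Lemma cobd_cochain0 (X : wcomplex R V) (g : 0.-tuple V -> G) : cochains X (cobd g).
Proof. exact: cochains1. Qed.

Lemma ord2P (i : 'I_2) : {i = ord0} + {i = ord_max}.
Proof. by case: i => -[|[|//]] i2; [left|right]; apply: val_inj. Qed.

Lemma cobd_cochain1 (X : wcomplex R V) (g : 1.-tuple V -> G) : cochains X (cobd g).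
Proof.
move=> t pi _; have [a [b ->]] := tuple2P t.
have neq : pi ord0 <> pi ord_max by move/perm_inj.
have [e|e] : pi = 1%g \/ pi = tperm ord0 ord_max.
  case: (ord2P (pi ord0)) neq => e0; case: (ord2P (pi ord_max)) => e1; rewrite e0 e1 // => _.
    by left; apply/permP=> i; case: (ord2P i) => ->; rewrite perm1.
  by right; apply/permP=> i; case: (ord2P i) => ->; rewrite ?tpermL ?tpermR.
  rewrite e odd_perm1; congr (cobd g _); apply: eq_from_tnth => i.
  by rewrite tnth_mktuple perm1.
rewrite [X in cobd g X]tuple2E !tnth_mktuple e tpermL tpermR odd_tperm.
have -> : tnth [tuple a; b] ord0 = a by [].
have -> : tnth [tuple a; b] ord_max = b by [].
by rewrite !cobd1E invMg invgK.
Qed.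

Lemma cobd_cobd0 (X : wcomplex R V) (g : 0.-tuple V -> G) (f : 1.-tuple V -> G) :
  (forall t, oface X t -> f t = cobd g t) ->
  (forall s t : {set V}, s \in faces X -> t \subset s -> t \in faces X) ->
  forall t, oface X t -> cobd f t = 1.
Proof.
move=> fg Xc t; have [a [b ->]] := tuple2P t => abX.
rewrite cobd1E !fg ?mulgV //; apply: (oface_sub Xc _ _ abX) => // v; rewrite !inE => ->//.
by rewrite orbT.
Qed.

Lemma cobd_cobd1 (X : wcomplex R V) (g : 1.-tuple V -> G) (f : 2.-tuple V -> G) :
  (forall t, oface X t -> f t = cobd g t) ->
  (forall s t : {set V}, s \in faces X -> t \subset s -> t \in faces X) ->
  forall t, oface X t -> cobd f t = 1.
Proof.
move=> fg Xc t; have [a [b [e ->]]] := tuple3P t => abeX.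
have u3 : uniq [:: a; b; e] by case/andP: abeX.
have {u3} /and3P[] := u3; rewrite !inE negb_or => /andP[ab ae] be _.
have sub x y : x != y -> x \in [:: a; b; e] -> y \in [:: a; b; e] -> oface X [tuple x; y].
  move=> xy xt yt; apply: (oface_sub Xc _ _ abeX); first by rewrite /= inE xy.
  by move=> v; rewrite !inE => /orP[]/eqP->; move: xt yt; rewrite !inE.
rewrite cobd2E !fg ?sub // ?inE ?eqxx ?orbT // 1?eq_sym // !cobd1E.
by rewrite !mulgA !mulgVK mulgV.
Qed.

End NonAbelian.

Section CorrectableOne.
Variables (R : realType) (V : finType) (G : groupType) (d : nat).
Variables (X : wcomplex R V) (c : V -> 'I_d).
Hypothesis hX : partite_complex X c.
Variable F : {set 'I_d}.
Local Open Scope group_scope.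

(** For s = {v}, agreement f(vr) = g(v) g(r)^-1 means that f(vr) g(r) is the constant g(v), so this
    product is the leftover. Its coboundary at (a, b) is f(va) f(ab) f(bv) whenever f(ab) = g(a)
    g(b)^-1. *)
Lemma correctable1 (Y : wcomplex R V) (s : {set V}) (f : 2.-tuple V -> G) (g : 1.-tuple V -> G) :
  #|s| = 1%N -> [disjoint col c s & F] ->
  faces Y = link_faces X c F s -> cochains X f ->
  correctable X c F 0 Y s f g.
Proof.
move=> /eqP/cards1P[v ->] sF fY cf.
exists (fun r => f [tuple v; tnth r ord0] * g r); split; first exact: cochains1.
  move=> r; rewrite inE => /andP[rY /eqP r2]; apply: contraLR.
  rewrite negb_or => /andP[/disagreeN nB].
  rewrite negb_exists => /forallP/(_ v); rewrite in_set1 eqxx andTb => /disagreeN nb.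
  apply/disagreeN=> t; have [a [b ->]] := tuple2P t => tr.
  have {}tr : r = [set a; b] by rewrite -tr -/(tset _) tset2.
  have := rY; rewrite fY inE => /and3P[rX rF rvX].
  have vr : v \notin r by rewrite (disjointFr (disjoint_by_color sF rF)) ?set11.
  have ab : a != b by move: r2; rewrite tr cards2; case: eqVneq.
  have eD : ([set v] :|: r) :\ v = r by rewrite setU1K.
  have := nb [tuple a; b]; rewrite -/(tset _) tset2 cobd1E eD -tr => /(_ erefl) e2.
  have := nB [tuple v; a; b]; rewrite -/(tset _) tset3 cobd2E tr -setUA => /(_ erefl).
  rewrite e2 (cochain_swap (u := b) (v := v) cf); last first.
    rewrite oface_level -/(tset _) tset2 inE cards2.
    have bv : b != v by apply: contraNneq vr => <-; rewrite tr !inE eqxx orbT.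
    rewrite bv andbT; apply: (faces_closed hX rvX).
    by rewrite tr; apply/subsetP=> w; rewrite !inE => /orP[]/eqP->; rewrite eqxx ?orbT.
  by rewrite cobd1E !tnth0 invMg !mulgA.
move=> h ch; exists (fun _ => h [tuple]); first exact: cochains1.
move=> r; rewrite inE => /andP[rY /eqP /eqP/cards1P[u ru]]; subst r.
apply: contraLR => /disagreeN/(_ [tuple u]).
rewrite -/(tset _) tset1 tnth0 => /(_ erefl) e0.
have {e0} e : f [tuple v; u] * g [tuple u] = h [tuple] by exact: e0.
have := rY; rewrite fY inE => /and3P[uX uF uvX].
have uv : u != v.
  by have := disjointFr (disjoint_by_color sF uF) (set11 v); rewrite inE eq_sym => ->.
have vuX : oface X [tuple v; u].
  rewrite oface_level -/(tset _) tset2 inE cards2 [v == u]eq_sym uv andbT.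
  by rewrite setUC.
have mv : mix c F [set v] (fun=> h [tuple]) g [tuple v] = h [tuple].
  by rewrite /mix tset1 outside_id ?eqxx.
have mu : mix c F [set v] (fun=> h [tuple]) g [tuple u] = g [tuple u].
  rewrite /mix tset1 outside0 // ifN //; apply/eqP => /setP/(_ v).
  by rewrite !inE eqxx.
have ef : f [tuple v; u] = h [tuple] * (g [tuple u])^-1 by rewrite -e mulgK.
apply/disagreeN=> t; have [a [b ->]] := tuple2P t; rewrite -/(tset _) tset2 => tab.
have : (a == v) && (b == u) || (a == u) && (b == v).
  have : a \in [set v; u] by rewrite -tab set21.
  rewrite !inE => /orP[]/eqP ea; subst a.
    have : u \in [set v; b] by rewrite tab set22.
    by rewrite !inE (negPf uv) /= [u == b]eq_sym => ->; rewrite eqxx.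
  have : v \in [set u; b] by rewrite tab set21.
  by rewrite !inE [v == u]eq_sym (negPf uv) /= [v == b]eq_sym => ->; rewrite eqxx.
case/orP=> /andP[/eqP-> /eqP->]; rewrite cobd1E mv mu //.
by rewrite (cochain_swap cf) ?ef ?invMg ?invgK // oface_level -/(tset _) tset2 setUC -tset2 -oface_level.
Qed.

End CorrectableOne.

(** * The correction and its average *)

Section Correction.
Variables (R : realType) (V : finType) (G : groupType) (d k : nat).
Variables (X : wcomplex R V) (c : V -> 'I_d).
Hypothesis hX : partite_complex X c.
Hypothesis cG : (1 < k)%N -> forall x y : G, (x * y = y * x)%g.
Implicit Types (s r u : {set V}) (F S : {set 'I_d}).

Local Notation Bad f := (disagree (cobd f) (fun _ => 1%g)).
Local Notation bad f g := (disagree f (cobd g)).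

(** For k <= 1 a nonempty [s] leaves only k = |s| = 1 and n = 0, so the explicit product covers
    every non-abelian case with [s] nonempty. *)
Lemma correctable_face F n (Y : wcomplex R V) s (f : k.+1.-tuple V -> G) (g : k.-tuple V -> G) :
  k = (n + #|s|)%N -> [disjoint col c s & F] -> faces Y = link_faces X c F s ->
  cochains X f -> cochains X g -> correctable X c F n Y s f g.
Proof.
move=> kn sF fY cf cg; have [k1|k1] := ltnP 1 k.
  exact: (correctable_abelian hX (cG k1)).
have [s0|s0] := eqVneq s set0.
  move: kn fY; rewrite s0 cards0 addn0 => kn; subst n => fY.
  exact: (correctable0 hX).
have s1 : #|s| = 1%N by apply/eqP; rewrite eqn_leq card_gt0 s0 andbT; lia.
have n0 : n = 0%N by lia.
clear k1 cG; move: kn f g cf cg; rewrite s1 n0 => ->.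
by move=> f g cf cg; apply: (correctable1 hX).
Qed.

Lemma closing F (f : k.+1.-tuple V -> G) (g : k.-tuple V -> G) u x :
  cochains X f -> cochains X g -> u \in level X k.+2 -> x \in u ->
  bad f g (u :\ x) -> Bad f u || [exists v in u :\ x, bad f g (u :\ v)].
Proof.
move=> cf cg uX xu; have [k1|k1] := ltnP 1 k.
  exact: (closing_abelian hX F (cG k1)).
clear cG; move: k k1 f g cf cg uX => [|[|//]] _ f g cf cg uX.
  exact: closing0.
exact: (closing1 uX).
Qed.

Lemma cobd_cochain (g : k.-tuple V -> G) : cochains X g -> cochains X (cobd g).
Proof.
move=> cg; have [k1|k1] := ltnP 1 k.
  exact: (cobd_cochain_abelian hX set0 (cG k1)).
clear cG; move: k k1 g cg => [|[|//]] _ g cg.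
  exact: cobd_cochain0.
exact: cobd_cochain1.
Qed.

Lemma cobd_cobd (g : k.-tuple V -> G) : cochains X g ->
  forall f : k.+1.-tuple V -> G, (forall t, oface X t -> f t = cobd g t) ->
  forall t, oface X t -> cobd f t = 1%g.
Proof.
move=> cg; have [k1|k1] := ltnP 1 k.
  by move=> f fg; apply: (cobd_cobd_abelian hX set0 (cG k1) k1 cg fg).
clear cG; move: k k1 g cg => [|[|//]] _ g cg f fg.
  exact: (cobd_cobd0 fg (faces_closed hX)).
exact: (cobd_cobd1 fg (faces_closed hX)).
Qed.

(** * Correcting a cochain for a fixed set of colors *)

Section Color.
Variable F : {set 'I_d}.
Variable beta : R.
Hypothesis beta_gt0 : 0 < beta.
Hypothesis expF : locally_expanding G X c F k beta.

(** Expansion of the link is applied to the leftover cochain. Clearing the denominators of [Pr_link]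
    cancels the common [mass X s] and leaves the two binomials. *)
Lemma correct_face n s (f : k.+1.-tuple V -> G) (g : k.-tuple V -> G) :
  s \in faces X -> k = (n + #|s|)%N -> [disjoint col c s & F] ->
  cochains X f -> cochains X g ->
  exists2 h : k.-tuple V -> G, cochains X h &
  beta * 'C(#|F|, n.+2)%:R *
     star_sum X c F n.+1 s (fun u => (bad f (mix c F s h g) u)%:R) <=
  'C(#|F|, n.+1)%:R * star_sum X c F n.+2 s
      (fun u => (Bad f u || [exists v in s, bad f g (u :\ v)])%:R).
Proof.
move=> sX kn sF cf cg.
set Y := normalized (link_faces X c F s) (fun t => mass X (t :|: s)).
have expY : coboundary_expanding G Y n.+1 beta.
  have [s0|s0] := eqVneq s set0.
    have := expF.1; rewrite color_restrE /Y s0.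
    by move: kn; rewrite s0 cards0 addn0 => ->.
  have s1 : (0 < #|s|)%N by rewrite card_gt0.
  have := expF.2 #|s|.-1 s; rewrite color_linkE.
  rewrite (_ : (k.+1 - #|s|)%N = n.+1); last by lia.
  by apply=> //; [lia|rewrite inE sX prednK /=].
have pr_ge0 r : r \in faces Y -> 0 <= level_pr Y r.
  move=> rY; rewrite /level_pr (mass_link hX) // mulr_ge0 ?invr_ge0 // divr_ge0 //.
    by apply/ltW/(mass_gt0 hX); move: rY; rewrite inE => /and3P[].
  exact/ltW/(mass_gt0 hX).
have [phi [cphi Bphi hphi]] := correctable_face (Y := Y) kn sF erefl cf cg.
have [h0 ch0 eh0] := expanding_elim pr_ge0 beta_gt0 expY cphi.
have [h ch bh] := hphi h0 ch0; exists h => //.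
have levelY m u S : u \in maxfaces X -> s \subset u -> S \subset F -> #|S| = m ->
    cpart c S u \in level Y m.
  move=> um su SF Sm; rewrite inE (card_cpart hX) // Sm eqxx andbT.
  by apply: (max_link_faces hX um su); rewrite ?cpart_sub ?(col_cpart hX).
move: eh0; rewrite !(Pr_link hX) //.
set S1 := \sum_(u in _ | _) _; set S2 := \sum_(u in _ | _) _.
set T1 := star_sum _ _ _ _ _ _; set T2 := star_sum _ _ _ _ _ _.
have ST1 : T1 <= S1.
  apply: ler_sum => u /andP[um su]; apply: ler_wpM2l; first exact: (weight_ge0 hX).
  apply: ler_sum => S /andP[SF /eqP Sn]; rewrite ler_nat.
  by have := bh _ (levelY _ _ _ um su SF Sn); case: disagree => // ->.
have ST2 : S2 <= T2.
  apply: ler_sum => u /andP[um su]; apply: ler_wpM2l; first exact: (weight_ge0 hX).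
  apply: ler_sum => S /andP[SF /eqP Sn]; rewrite ler_nat.
  by have := Bphi _ (levelY _ _ _ um su SF Sn); case: disagree => // ->.
have T10 : 0 <= T1.
  apply: sumr_ge0 => u /andP[um _]; rewrite mulr_ge0 ?(weight_ge0 hX) //.
  exact: sumr_ge0.
have m0 := mass_gt0 hX sX.
(* If F has fewer than n + 2 colors, the left-hand side is zero and denominators are not to be
   cleared. *)
have [C20|C2] := posnP 'C(#|F|, n.+2).
  rewrite C20 mulr0 mul0r => _; rewrite mulr_ge0 //.
  apply: sumr_ge0 => u /andP[um _]; rewrite mulr_ge0 ?(weight_ge0 hX) //.
  exact: sumr_ge0.
have C1 : (0 < 'C(#|F|, n.+1))%N by move: C2; rewrite !bin_gt0; apply: ltnW.
move: C1 C2; rewrite -!(ltr0n R).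
move: 'C(#|F|, n.+1)%:R 'C(#|F|, n.+2)%:R => c1 c2 c1_gt0 c2_gt0 e.
have {}e : beta * c2 * S1 <= c1 * S2.
  have := ler_wpM2l (ltW (mulr_gt0 (mulr_gt0 c1_gt0 c2_gt0) m0)) e.
  have -> : c1 * c2 * mass X s * (beta * ((c1 * mass X s)^-1 * S1)) = beta * c2 * S1.
    by field; rewrite !lt0r_neq0.
  have -> : c1 * c2 * mass X s * ((c2 * mass X s)^-1 * S2) = c1 * S2.
    by field; rewrite !lt0r_neq0.
  by [].
apply: le_trans (_ : beta * c2 * S1 <= _).
  by apply: ler_wpM2l => //; rewrite mulr_ge0 // ltW.
by apply: le_trans e _; apply: ler_wpM2l => //; apply: ltW.
Qed.

(** A face [s] with i outside vertices is completed by k + 1 - i vertices with colors in F for the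
    values of [f], and by one more for those of its coboundary. *)
Definition corrected (f : k.+1.-tuple V -> G) (g : k.-tuple V -> G) i : Prop :=
  forall s, s \in level X i -> [disjoint col c s & F] ->
  (if (i <= k)%N then beta else 1) * 'C(#|F|, (k.+1 - i).+1)%:R *
     star_sum X c F (k.+1 - i)%N s (fun u => (bad f g u)%:R) <=
  'C(#|F|, k.+1 - i)%:R * star_sum X c F (k.+1 - i).+1 s
      (fun u => (Bad f u || [exists v in s, bad f g (u :\ v)])%:R).

Lemma eq_bad (f : k.+1.-tuple V -> G) (g h : k.-tuple V -> G) u : #|u| = k.+1 ->
  (forall r : k.-tuple V, uniq r -> tset r \subset u -> g r = h r) ->
  bad f g u = bad f h u.
Proof.
move=> uk gh; apply: eq_disagree => t tu; apply: cobd_local.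
  by rewrite uniq_card_tuple tu uk.
move=> r ur rt; apply: gh => //; rewrite -tu.
by apply/subsetP=> v; rewrite !inE; apply: rt.
Qed.

Lemma outsideS r u : r \subset u -> outside c F r \subset outside c F u.
Proof. by move=> /subsetP ru; apply/subsetP=> v; rewrite !inE => /andP[/ru -> ->]. Qed.

(** All faces [s] with j vertices are corrected at once, since a tuple has only one outside part.
    Faces with fewer than j outside vertices do not see the change, so the earlier inequalities
    persist. *)
Lemma corrected_up_to (f : k.+1.-tuple V -> G) j : cochains X f -> (j <= k.+1)%N ->
  exists2 g : k.-tuple V -> G, cochains X g & forall i, (i < j)%N -> corrected f g i.
Proof.
move=> cf; elim: j => [_|j IH jk].
  by exists (fun _ => 1%g) => // t pi _; rewrite invg1 if_same.
have [g cg gi] := IH (ltnW jk).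
have /choice[H HP] s : exists h : k.-tuple V -> G, cochains X h /\
    (s \in level X j -> [disjoint col c s & F] ->
     beta * 'C(#|F|, (k.+1 - j).+1)%:R *
     star_sum X c F (k.+1 - j)%N s (fun u => (bad f (mix c F s h g) u)%:R) <=
     'C(#|F|, k.+1 - j)%:R * star_sum X c F (k.+1 - j).+1 s
      (fun u => (Bad f u || [exists v in s, bad f g (u :\ v)])%:R)).
  have [sX|] := boolP (s \in level X j); last by exists g.
  have [sF|] := boolP [disjoint col c s & F]; last by exists g.
  have := sX; rewrite inE => /andP[sfX /eqP sj].
  have kj : k = (k - j + #|s|)%N by rewrite sj subnK.
  have [h ch hh] := correct_face sfX kj sF cf cg.
  by exists h; split=> // _ _; rewrite subSn.
pose g' (t : k.-tuple V) :=
  let o := outside c F (tset t) in if #|o| == j then H o t else g t.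
have cg' : cochains X g'.
  move=> t pi tX; rewrite /g' {1 2}/tset set_tuple_perm -/(tset t).
  by case: ifP => _; [apply: (HP _).1 | apply: cg].
have out u S s : u \in maxfaces X -> S \subset F -> [disjoint col c s & F] ->
    outside c F (s :|: cpart c S u) = s.
  by move=> um SF sF; rewrite outsideU outside_id // outside0 ?setU0 // (col_cpart hX).
have card u S s i m : u \in maxfaces X -> S \subset F -> [disjoint col c s & F] ->
    s \in level X i -> #|S| = m -> #|s :|: cpart c S u| = (i + m)%N.
  move=> um SF sF; rewrite inE => /andP[_ /eqP <-] <-; rewrite cardsU disjoint_setI0.
    by rewrite cards0 subn0 (card_cpart hX).
  by apply: disjoint_by_color sF _; rewrite (col_cpart hX).
have low u : #|u| = k.+1 -> (#|outside c F u| < j)%N -> bad f g' u = bad f g u.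
  move=> uk uj; apply: eq_bad => // r _ ru; rewrite /g' ifN //.
  by rewrite neq_ltn (leq_ltn_trans (subset_leq_card (outsideS ru)) uj).
(* On the right, deleting v leaves at most j - 1 outside vertices, so [low] applies even for i =
   j. *)
have eqR s i : s \in level X i -> (i <= j)%N -> [disjoint col c s & F] ->
    star_sum X c F (k.+1 - i).+1 s
      (fun u => (Bad f u || [exists v in s, bad f g' (u :\ v)])%:R) =
    star_sum X c F (k.+1 - i).+1 s
      (fun u => (Bad f u || [exists v in s, bad f g (u :\ v)])%:R).
  move=> sX ij sF; apply: eq_bigr => u /andP[um _]; congr (_ * _).
  apply: eq_bigr => S /andP[SF /eqP Sn]; congr ((_ || _)%:R).
  apply: eq_existsb => v; case vs: (v \in s) => //=; apply: low.
    have := card _ _ _ _ _ um SF sF sX Sn.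
    by rewrite (cardsD1 v) inE vs /= add1n; lia.
  apply: leq_trans ij; have := sX; rewrite inE => /andP[_ /eqP <-].
  rewrite (cardsD1 v s) vs ltnS; apply: subset_leq_card.
  apply: subset_trans (_ : outside c F (s :|: cpart c S u) :\ v \subset _).
    by apply/subsetP=> w; rewrite !inE -andbA.
  by rewrite out.
exists g' => // i; rewrite ltnS leq_eqVlt => /orP[/eqP->|ij] s sX sF.
  rewrite eqR //; have := (HP s).2 sX sF; rewrite -ltnS jk.
  apply: le_trans; rewrite le_eqVlt; apply/orP; left; apply/eqP; congr (_ * _).
  apply: eq_bigr => u /andP[um _]; congr (_ * _).
  apply: eq_bigr => S /andP[SF /eqP Sn]; congr (nat_of_bool _)%:R.
  apply: eq_bad => [|r _ ru]; first by rewrite (card _ _ _ _ _ um SF sF sX Sn); lia.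
  (* Within a face of outside part [s], a tuple with j outside vertices has outside part exactly
     [s]; there [g'] coincides with the correction made for [s] alone. *)
  rewrite /g' /mix; have rs := outsideS ru; rewrite out // in rs.
  have := sX; rewrite inE => /andP[_ /eqP <-].
  have -> : (#|outside c F (tset r)| == #|s|) = (outside c F (tset r) == s).
    by rewrite eqEcard rs eqn_leq subset_leq_card.
  by case: eqP => [->|].
rewrite eqR //; last exact: ltnW.
have := gi i ij s sX sF; apply: le_trans.
rewrite le_eqVlt; apply/orP; left; apply/eqP; congr (_ * _).
apply: eq_bigr => u /andP[um _]; congr (_ * _).
apply: eq_bigr => S /andP[SF /eqP Sn]; congr (nat_of_bool _)%:R.
apply: low; first by rewrite (card _ _ _ _ _ um SF sF sX Sn); lia.
by rewrite out //; move: sX; rewrite inE => /andP[_ /eqP ->].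
Qed.

(** For each color of F, [s] is completed by the vertex of that color in the ambient maximal face,
    and [closing] applies. Summing over the colors gives the factor |F| = C(|F|, 1) on the left. *)
Lemma corrected_last (f : k.+1.-tuple V -> G) (g : k.-tuple V -> G) :
  cochains X f -> cochains X g -> corrected f g k.+1.
Proof.
move=> cf cg s sX sF; rewrite ltnn subnn bin1 bin0 !mul1r /star_sum mulr_sumr.
apply: ler_sum => u /andP[um su]; rewrite mulrCA.
apply: ler_wpM2l; first exact: (weight_ge0 hX).
rewrite (big_pred1 set0); last first.
  by move=> S /=; rewrite cards_eq0; case: eqVneq => [->|]; rewrite ?sub0set ?andbF.
have -> : cpart c set0 u = set0 by apply/setP=> v; rewrite !inE andbF.
rewrite setU0.
apply: le_trans (_ : \sum_(i in F) (Bad f (s :|: cpart c [set i] u) ||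
   [exists v in s, bad f g ((s :|: cpart c [set i] u) :\ v)])%:R <= _).
  rewrite mulr_natl -sumr_const; apply: ler_sum => i iF; rewrite ler_nat.
  have /cards1P[x ex] : #|cpart c [set i] u| == 1%N by rewrite (card_cpart hX) // cards1.
  have cx : c x \in F.
    have : x \in cpart c [set i] u by rewrite ex set11.
    by rewrite !inE => /andP[_ /eqP->].
  have xs : x \notin s by apply: contraL cx; apply: disjoint_col.
  rewrite ex; have xU : x \in s :|: [set x] by rewrite !inE eqxx orbT.
  have sE : (s :|: [set x]) :\ x = s by rewrite setUC setU1K.
  have UX : s :|: [set x] \in level X k.+2.
    rewrite inE setUC cardsU1 xs setUC.
    move: sX; rewrite inE => /andP[_ /eqP->]; rewrite eqxx andbT.
    by apply: (sub_max_face hX um); rewrite subUset su -ex cpart_sub.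
  have := closing F cf cg UX xU; rewrite sE.
  by case: (bad f g s) => // ->.
rewrite [leRHS](eq_bigl (mem [set [set i] | i in F])); last first.
  move=> S; apply/andP/imsetP => [[SF /cards1P[i eS]]|[i iF ->]].
    by exists i => //; apply: (subsetP SF); rewrite eS set11.
  by rewrite sub1set cards1.
by rewrite big_imset //= => i j _ _ /set1_inj.
Qed.

Lemma exists_correction (l : nat) (f : k.+1.-tuple V -> G) : #|F| = l ->
  cochains X f ->
  exists2 g : k.-tuple V -> G, cochains X g &
  layer_recursion l k (color_avg X c (fun u => (Bad f u)%:R)) beta F
    (color_avg X c (fun u => (bad f g u)%:R)).
Proof.
move=> cF cf; have [g cg gi] := corrected_up_to cf (leqnn k.+1).
exists g => // j jk.
have gj : corrected f g j.
  by move: jk; rewrite leq_eqVlt => /orP[/eqP->|/gi//]; apply: corrected_last.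
have := star_sum_layer hX gj.
by rewrite cF addSn subnK // -subSn.
Qed.

End Color.

End Correction.

Theorem theorem4p1 (R : realType) (V : finType) (G : groupType)
    (k l d : nat) (beta p : R) (X : wcomplex R V) (c : V -> 'I_d) :
  (k + 2 <= l)%N -> (l <= d)%N ->
  0 < beta <= 1 -> 0 < p <= 1 ->
  ((1 < k)%N -> forall x y : G, (x * y = y * x)%g) ->
  partite_complex X c ->
  p <= Pr_subset R l (fun F => locally_expanding G X c F k beta) ->
  coboundary_expanding G X k.+1
    (p * beta ^+ k.+1 / (expR 1 * ((k + 2)`!)%:R)).
Proof.
move=> kl ld /andP[b0 b1] /andP[p0 _] cG hX hp.
have e1 : 1 <= expR 1 :> R by apply: le_trans (expR_ge1Dx 1); rewrite lerDl.
have fact0 : 0 < (k + 2)`!%:R :> R by rewrite ltr0n fact_gt0.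
have e0 : 0 < expR 1 :> R by apply: expR_gt0.
have K0 : 0 < p * beta ^+ k.+1 by rewrite mulr_gt0 // exprn_gt0.
have lpr_gt0 s : s \in faces X -> 0 < level_pr X s.
  move=> sX; rewrite /level_pr mulr_gt0 ?(mass_gt0 hX) // invr_gt0 ltr0n bin_gt0.
  by rewrite (rankX hX) -(card_col hX sX) -[leqRHS]card_ord max_card.
apply: expanding_intro.
- by move=> s /lpr_gt0/ltW.
- by rewrite divr_gt0 // mulr_gt0.
- by move=> s; rewrite inE => /andP[/lpr_gt0].
- exact: (cobd_cochain hX cG).
- exact: (cobd_cobd hX cG).
move=> f cf.
pose H := color_avg X c (fun u => (disagree (cobd f) (fun _ => 1%g) u)%:R).
have H0 U : 0 <= H U by apply: (color_avg_ge0 hX).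
set w := Pr X k.+2 _.
have w0 : 0 <= w by apply: Pr_ge0 => s /lpr_gt0/ltW.
pose M := 'C(d, k.+1)%:R * (k.+2)`!%:R * w.
have M0 : 0 <= M by rewrite !mulr_ge0.
have wE : w = 'C(d, k.+2)%:R^-1 * \sum_(U : {set 'I_d} | #|U| == k.+2) H U.
  exact: (Pr_color_avg hX).
(* The mean of [total_bound] over all F of size l is at most [M], which is (k + 2)! w times the
   number of color sets of size k + 1. *)
have PhiM := sum_total_bound kl ld H0; rewrite -wE mulrCA -/M in PhiM.
have [F [cF /asboolP gF pF]] := exists_below_average
  (good := fun F => `[< locally_expanding G X c F k beta >])
  (total_bound_ge0 l k H0) M0 p0 ld hp PhiM.
have [g cg rec] := exists_correction hX cG b0 gF cF cf.
exists g => //.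
have := layer_recursion_total kl ld H0 b0 b1 cF (color_avg_ge0 hX _) rec.
rewrite (Pr_color_avg hX).
set S := \sum_(U | _) _ => bS.
have C0 : 0 < 'C(d, k.+1)%:R :> R by rewrite ltr0n bin_gt0; lia.
have {bS} pS : p * beta ^+ k.+1 * S <= 'C(d, k.+1)%:R * ((k + 2)`!%:R * w).
  by rewrite addn2 mulrA; apply: le_trans pF; rewrite -mulrA ler_pM2l.
(* Dividing [S] by C(d, k + 1) gives the probability of disagreement; the constant of the statement
   then follows from e >= 1. *)
rewrite mulrAC ler_pdivrMr ?mulr_gt0 // mulrCA mulrC ler_pdivrMr //.
apply: le_trans pS _.
rewrite [leRHS](_ : _ = 'C(d, k.+1)%:R * ((k + 2)`!%:R * w) * expR 1); last by ring.
by apply: ler_peMr; rewrite // mulr_ge0 // mulr_ge0.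
Qed.
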